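(* Let $\beta=\mathrm{age}_{\mathrm{opt}}$. Then $\beta$ is a root of $$\mathbb E\Big[\int_Y^{\max(\beta-\frac{\mathbb E[Y]}{1-\alpha},\,Y)+Y'}t\,dt\Big]-\beta\,\mathbb E\Big[\max\Big(\beta-Y,\ \frac{\mathbb E[Y]}{1-\alpha}\Big)\Big]=0,$$ and the policy $S_{i+1}=\inf\{t\ge D_i:\ \Delta_t\ge\beta-\frac{\mathbb E[Y]}{1-\alpha}\}$, $i=0,1,\dots$, is optimal for the problem defining $\mathrm{age}_{\mathrm{opt}}$.
   Context: System model: samples are taken at times $S_1\le S_2\le\cdots$, $D_0=0$; sample $i$ has transmission time $Y_i$ and delivery time $D_i=S_i+Y_i$, delivered successfully with probability $1-\alpha$, lost with probability $\alpha\in[0,1)$. The $Y_i$ are i.i.d. copies of a random variable $Y$ with $Y\ge\epsilon>0$ a.s. and $\mathbb E[Y^2]<\infty$; success indicators are i.i.d. and independent of $(Y_i)$. Outcomes are known at $D_i$ and $S_{i+1}\ge D_i$. For $t\in[D_i,D_{i+1})$ the age is $\Delta_t=t-S_{\underline i}$, where $\underline i$ is the largest index $\le i$ whose sample was successfully delivered. $\Pi_{\text{signal-agnostic}}$ is the set of policies with $S_i\ge D_{i-1}$, sampling decisions depending only on past timing/outcome information (independent of the Wiener source), and $S_i-D_{i-1}$ bounded by a random variable with finite second moment independent of the history before $S_{i-1}$. $\mathrm{age}_{\mathrm{opt}}=\inf_{\Pi_{\text{signal-agnostic}}}\limsup_{T\to\infty}\frac1T\mathbb E[\int_0^T\Delta_tdt]$.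 In the root equation, $M$ is geometric with $P(M=m)=\alpha^{m-1}(1-\alpha)$, $m\ge1$, $Y,Y_{1},Y_{2},\dots$ are i.i.d. copies of $Y$ independent of $M$, and $Y'=\sum_{k=1}^M Y_k$. *)

(* Defs.v *)
From HB Require Import structures.
From mathcomp Require Import all_boot all_order all_algebra.
From mathcomp Require Import all_classical all_reals all_analysis.
Set Implicit Arguments. Unset Strict Implicit. Unset Printing Implicit Defensive.
Import Order.TTheory GRing.Theory Num.Theory.
Import numFieldNormedType.Exports.
Local Open Scope classical_set_scope.
Local Open Scope ring_scope.

Definition law_eq {d} {Omega : measurableType d} {R : realType} (P : probability Omega R) {d'} {Omega' : measurableType d'} (P' : probability Omega' R)
  (X : Omega -> R) (X' : Omega' -> R) : Prop :=
  forall B : set R, measurable B -> P (X @^-1` B) = P' (X' @^-1` B).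

Definition mutually_independent {d} {Omega : measurableType d} {R : realType} (P : probability Omega R) {I : eqType} (X : I -> Omega -> R) : Prop :=
  forall (J : seq I) (B : I -> set R), uniq J -> (forall i, measurable (B i)) ->
    fine (P (\big[setI/setT]_(i <- J) (X i @^-1` B i)))
    = \prod_(i <- J) fine (P (X i @^-1` B i)).


Section model.
Context {d : measure_display} {Omega : measurableType d} {R : realType}.
Variable P : probability Omega R.

Definition sigma_gen (Xs : set (Omega -> R)) : set (set Omega) :=
  <<s [set A | exists2 X, Xs X & exists2 B : set R, measurable B & A = X @^-1` B] >>.

Definition measurable_wrt (F : set (set Omega)) (Z : Omega -> R) : Prop :=
  forall B : set R, measurable B -> F (Z @^-1` B).

Definition indep_sigma (F G : set (set Omega)) : Prop :=
  forall A B, F A -> G B -> P (A `&` B) = (P A * P B)%E.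

Definition succR (succ : nat -> Omega -> bool) (k : nat) : Omega -> R :=
  fun w => (succ k w)%:R.

(** the system family: transmission times Y_i and success indicators, i >= 1 *)
Definition sys_family (Y : nat -> Omega -> R) (succ : nat -> Omega -> bool)
  (x : nat + nat) : Omega -> R :=
  match x with inl k => Y k.+1 | inr k => succR succ k.+1 end.

(** A policy: an auxiliary randomization source U and the waiting times
    Z_i = S_{i+1} - D_i (i >= 0). *)
Record policy := Policy { pol_U : Omega -> R; pol_Z : nat -> Omega -> R }.

Section dynamics.
Variables (Y : nat -> Omega -> R) (succ : nat -> Omega -> bool) (pi : policy).

Fixpoint deliv (i : nat) (w : Omega) : R :=
  match i with 0%N => 0 | j.+1 => deliv j w + pol_Z pi j w + Y j.+1 w end.

(** S_0 = 0 (fictitious initial sample, delivered at D_0 = 0), S_{i+1} = D_i + Z_i *)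
Definition samp (i : nat) (w : Omega) : R :=
  match i with 0%N => 0 | j.+1 => deliv j w + pol_Z pi j w end.

Definition delivered (k : nat) (w : Omega) : bool := (k == 0)%N || succ k w.

(** Age: Delta_t = t - S_{underline i}, where underline i is the latest
    successfully delivered sample among those delivered by time t. *)
Definition age (t : R) (w : Omega) : R :=
  t - sup [set samp k w | k in [set k | delivered k w /\ deliv k w <= t]].

Definition avg_age (T : R) : \bar R :=
  ((T^-1)%:E * \int[P]_w (\int[@lebesgue_measure R]_(t in `[0%R, T]) (age t w)%:E))%E.

Definition avg_cost : \bar R := limf_esup avg_age (pinfty_nbhs R).

Definition in_Pi : Prop :=
  [/\ measurable_fun setT (pol_U pi),
      indep_sigma (sigma_gen [set pol_U pi])
                  (sigma_gen [set X | exists x, X = sys_family Y succ x]),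
      (forall i w, 0 <= pol_Z pi i w),
      (forall i, measurable_wrt
         (sigma_gen [set X | X = pol_U pi \/
            exists2 k, (1 <= k <= i)%N & (X = Y k \/ X = succR succ k)])
         (pol_Z pi i)) &
      (* S_{n+1} - D_n bounded by a r.v. with finite second moment, independent
         of the history before S_n *)
      (forall n : nat, exists B : Omega -> R,
         [/\ measurable_fun setT B,
             {ae P, forall w, pol_Z pi n w <= B w},
             ('E_P[fun w => (B w ^+ 2)%R] < +oo)%E &
             indep_sigma (sigma_gen [set B])
               (sigma_gen [set X |
                  (exists2 k, (1 <= k < n)%N & (X = Y k \/ X = succR succ k)) \/
                  (exists2 k, (k.+2 <= n)%N & X = pol_Z pi k)])])].

Definition threshold_policy (theta : R) : Prop :=
  forall i : nat, {ae P, forall w,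
    samp i.+1 w = inf [set t | deliv i w <= t /\ theta <= age t w]}.

End dynamics.

Definition age_opt (Y : nat -> Omega -> R) (succ : nat -> Omega -> bool) : \bar R :=
  ereal_inf [set avg_cost Y succ pi | pi in [set pi | in_Pi Y succ pi]].

Definition cY (Y : nat -> Omega -> R) (alpha : R) : R :=
  fine ('E_P[Y 1%N]) / (1 - alpha).

(** The root equation, stated for every realization of
    Y, M (geometric), Y_1, Y_2, ... (i.i.d. copies of Y, independent of M). *)
Definition root_eq (Y : nat -> Omega -> R) (alpha beta : R) : Prop :=
  forall (d' : measure_display) (Omega' : measurableType d') (P' : probability Omega' R)
    (Yr : Omega' -> R) (M : Omega' -> nat) (Ys : nat -> Omega' -> R),
    measurable_fun setT Yr ->
    measurable_fun setT (fun w => (M w)%:R : R) ->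
    (forall k, measurable_fun setT (Ys k)) ->
    law_eq P P' (Y 1%N) Yr ->
    (forall k, (1 <= k)%N -> law_eq P P' (Y 1%N) (Ys k)) ->
    (forall m, (1 <= m)%N -> P' [set w | M w = m] = (alpha ^+ m.-1 * (1 - alpha))%:E) ->
    mutually_independent P'
      (fun k : nat => match k with
                      | 0%N => Yr
                      | 1%N => fun w => (M w)%:R
                      | k'.+2 => Ys k'.+1 end) ->
    let c := cY Y alpha in
    let Y' := fun w => \sum_(1 <= k < (M w).+1) Ys k w in
    (\int[P']_w (\int[@lebesgue_measure R]_(t in `[Yr w, (Num.max (beta - c) (Yr w) + Y' w)%R]) t%:E)
     - beta%:E * 'E_P'[fun w => Num.max (beta - Yr w)%R c])%E = 0%E.

End model.

(* Main.v *)
Require Import Defs.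
From HB Require Import structures.
From mathcomp Require Import all_boot all_order all_algebra.
From mathcomp Require Import all_classical all_reals all_analysis.
From mathcomp Require Import measurable_realfun ring lra.
Import Order.TTheory GRing.Theory Num.Theory.
Import numFieldNormedType.Exports.
Local Open Scope classical_set_scope.
Local Open Scope ring_scope.
Set Implicit Arguments.
Unset Strict Implicit.
Unset Printing Implicit Defensive.

(** Write [c = E Y / (1 - alpha)] and [theta = beta - c].  The relative value function
    [h x = max (x - theta) 0 ^ 2 / 2 - x ^ 2 / 2 + beta * x] solves the average-cost Bellman
    equation with gain [beta] as soon as [E (max (Y - theta) 0 ^ 2)] equals
    [theta ^ 2 + 2 * alpha * c * theta - alpha * E (Y ^ 2) / (1 - alpha)], which is the root
    equation with the moments of the geometric sum [Y'] evaluated.  At [theta = 0] this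
    quadratic is nonpositive, and it grows without bound while the left-hand side is at most
    [E (Y ^ 2)], so a root [theta >= 0] exists.  For every policy, the cost minus [beta] times
    the elapsed time plus [h (age)] is a submartingale along the delivery times, and a
    martingale for the threshold policy.  Stopping it at the first delivery after [T] compares
    [E (int_0^T age)] with [beta * T]: the error involves the square of the last transmission
    time, whose mean is [o(T)] since [E (Y ^ 2)] is finite, and its product with the age [A]
    at time [T], which is absorbed by the cost because [A ^ 2 / 2 <= int_0^T age]. *)

(** * Integrals, means and laws *)

Section ae_integral.
Context d (T : measurableType d) (R : realType) (mu : {measure set T -> \bar R}).
Local Open Scope ereal_scope.
Import HBNNSimple.

(* Unlike [ae_ge0_le_integral], no measurability is assumed: nothing is known of the
   age on the null set of outcomes with a transmission time below [eps]. *)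
Lemma ge0_ae_le_integral (f g : T -> \bar R) :
  (forall x, 0 <= f x) -> (forall x, 0 <= g x) ->
  {ae mu, forall x, f x <= g x} ->
  \int[mu]_x f x <= \int[mu]_x g x.
Proof.
move=> f0 g0 [N [mN N0 subN]].
rewrite (ge0_integralE mu (f := f))// (ge0_integralE mu (f := g))//.
rewrite !patch_setT; apply: ge_ereal_sup => _ [h /= hf <-].
have [hN hNE] : exists hN : {nnsfun T >-> R},
    forall x, hN x = (h x * \1_(~` N) x)%R by exists (proj_nnsfun h (measurableC mN)).
have -> : sintegral mu h = sintegral mu hN.
  rewrite -!integralT_nnsfun; apply: ge0_ae_eq_integral => //.
  - exact/measurable_EFinP/measurable_funP.
  - exact/measurable_EFinP/measurable_funP.
  - by move=> x _; rewrite lee_fin.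
  - by move=> x _; rewrite lee_fin.
  exists N; split => // x /= hx; apply: contrapT => Nx; apply: hx => _.
  by rewrite hNE indicE mem_set//= mulr1.
apply: ereal_sup_ubound; exists hN => //= x; rewrite hNE indicE.
have [Nx|Nx] := pselect (N x); first by rewrite memNset ?mulr0//; exact/not_notP.
rewrite mem_set//= mulr1; apply: (le_trans (hf x)).
by apply: contrapT => fg; apply: Nx; exact: subN.
Qed.

Lemma eq_ae_integral (f g : T -> \bar R) :
  {ae mu, forall x, f x = g x} -> \int[mu]_x f x = \int[mu]_x g x.
Proof.
move=> fg; have le_parts (h : (T -> \bar R) -> T -> \bar R) :
    (forall u x, 0 <= h u x) -> (forall u v x, u x = v x -> h u x = h v x) ->
    \int[mu]_x h f x = \int[mu]_x h g x.
  move=> h0 hE; apply/eqP; rewrite eq_le; apply/andP; split;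
    apply: ge0_ae_le_integral => //; apply: filterS fg => x fgx.
  - by rewrite (hE f g).
  - by rewrite (hE f g).
rewrite integralE [RHS]integralE; congr (_ - _); apply: le_parts => // u v x uv.
- by rewrite !funeposE uv.
- by rewrite !funenegE uv.
Qed.

End ae_integral.

Section limf_esup_near.
Context {T : choiceType} {X : filteredType T} {R : realType}
  (F : set_system X) (f : X -> \bar R).
Local Open Scope ereal_scope.

Lemma limf_esup_le_near (a : \bar R) :
  (\forall x \near F, f x <= a) -> limf_esup f F <= a.
Proof.
move=> fa; rewrite limf_esupE.
apply: le_trans (ereal_inf_lbound _) (_ : ereal_sup (f @` [set x | f x <= a]) <= _).
  by exists [set x | f x <= a].
by apply: ge_ereal_sup => _ [x /= ? <-].
Qed.

Lemma limf_esup_ge_near (a : \bar R) : ProperFilter F ->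
  (\forall x \near F, a <= f x) -> a <= limf_esup f F.
Proof.
move=> FF af; rewrite limf_esupE; apply: le_ereal_inf_tmp => _ [A FA <-].
have [x [Ax afx]] := filter_ex (filterI FA af).
by apply: le_trans afx _; apply: ereal_sup_ubound; exists x.
Qed.

End limf_esup_near.

Section has_mean.
Context {d : measure_display} {Omega : measurableType d} {R : realType}.
Variable P : probability Omega R.
Implicit Types (f g : Omega -> R) (a b k : R).

Definition has_mean f a : Prop :=
  P.-integrable setT (EFin \o f) /\ \int[P]_w f w = a.

Lemma eq_has_mean f g a : f =1 g -> has_mean f a -> has_mean g a.
Proof. by move=> /funext ->. Qed.

Lemma has_mean_integral f a : has_mean f a -> (\int[P]_w (f w)%:E)%E = a%:E.
Proof. by move=> [f_int <-]; rewrite /Rintegral fineK// integrable_fin_num. Qed.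

Lemma has_mean_expectation f a : has_mean f a -> ('E_P[f] = a%:E)%E.
Proof. by rewrite unlock; exact: has_mean_integral. Qed.

Lemma has_mean_measurable f a : has_mean f a -> measurable_fun setT f.
Proof. by move=> [/(measurable_int P) /measurable_EFinP]. Qed.

Lemma ge0_has_mean f a : measurable_fun setT f -> (forall w, 0 <= f w) ->
  (\int[P]_w (f w)%:E)%E = a%:E -> has_mean f a.
Proof.
move=> mf f0 fa; split; last by rewrite /Rintegral fa.
apply/integrableP; split; first exact/measurable_EFinP.
by under eq_integral do rewrite /= ger0_norm//; rewrite fa ltry.
Qed.

Lemma has_meanD f g a b :
  has_mean f a -> has_mean g b -> has_mean (fun w => f w + g w) (a + b).
Proof.
move=> [f_int <-] [g_int <-]; split; last by rewrite RintegralD.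
exact: (integrableD measurableT f_int g_int).
Qed.

Lemma has_meanZ k f a : has_mean f a -> has_mean (fun w => k * f w) (k * a).
Proof.
move=> [f_int <-]; split; last by rewrite RintegralZl.
exact: (integrableZl measurableT k f_int).
Qed.

Lemma has_meanB f g a b :
  has_mean f a -> has_mean g b -> has_mean (fun w => f w - g w) (a - b).
Proof.
move=> [f_int <-] [g_int <-]; split; last by rewrite RintegralB.
exact: (integrableB measurableT f_int g_int).
Qed.

Lemma has_mean_cst k : has_mean (fun=> k) k.
Proof.
split; first exact: finite_measure_integrable_cst.
by rewrite Rintegral_cst// -[X in _ * X]/(fine (P setT)) probability_setT mulr1.
Qed.

Lemma has_mean_sum n (f : nat -> Omega -> R) (a : nat -> R) :
  (forall i, has_mean (f i) (a i)) ->
  has_mean (fun w => \sum_(i < n) f i w) (\sum_(i < n) a i).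
Proof.
move=> fa; elim: n => [|n IHn].
  by rewrite big_ord0; apply: eq_has_mean (has_mean_cst 0) => w; rewrite big_ord0.
rewrite big_ord_recr/=; apply: eq_has_mean (has_meanD IHn (fa n)) => w.
by rewrite big_ord_recr.
Qed.

Lemma ae_eq_has_mean f g a : has_mean f a -> measurable_fun setT g ->
  {ae P, forall w, f w = g w} -> has_mean g a.
Proof.
move=> [f_int <-] mg fg.
have intE (h : R -> \bar R) : (\int[P]_w h (f w) = \int[P]_w h (g w))%E.
  by apply: eq_ae_integral; apply: filterS fg => w ->.
split; last by rewrite /Rintegral intE.
apply/integrableP; split; first exact/measurable_EFinP.
by rewrite -(intE (fun x => `|x%:E|%E)); move/integrableP : f_int => [].
Qed.

Lemma ae_le_has_mean f g a b : has_mean f a -> has_mean g b ->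
  {ae P, forall w, f w <= g w} -> a <= b.
Proof.
move=> fa gb fg; rewrite -subr_ge0.
have mfg : measurable_fun setT (fun w => Num.max (g w - f w) 0).
  by apply: measurable_maxr => //; exact: has_mean_measurable (has_meanB gb fa).
have [_ <-] : has_mean (fun w => Num.max (g w - f w) 0) (b - a).
  apply: ae_eq_has_mean (has_meanB gb fa) mfg _.
  by apply: filterS fg => w fgw; rewrite max_l// subr_ge0.
by apply: Rintegral_ge0 => w _; rewrite le_max lexx orbT.
Qed.

Lemma ae_le_normr_has_mean f g a : has_mean g a -> measurable_fun setT f ->
  {ae P, forall w, `|f w| <= g w} -> has_mean f (\int[P]_w f w).
Proof.
move=> [/integrableP[_ g_fin] _] mf fg; split => //.
apply/integrableP; split; first exact/measurable_EFinP.
apply: le_lt_trans g_fin; apply: ge0_ae_le_integral => //.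
by apply: filterS fg => w fgw; rewrite lee_fin (le_trans fgw)// ler_norm.
Qed.

End has_mean.

Lemma preimage_measurable d d' (T : measurableType d) (T' : measurableType d')
    (f : T -> T') (B : set T') :
  measurable_fun setT f -> measurable B -> measurable (f @^-1` B).
Proof. by move=> mf mB; rewrite -[_ @^-1` _]setTI; exact: mf. Qed.

Section law_eq.
Context {d d' : measure_display} {Omega : measurableType d} {Omega' : measurableType d'}
  {R : realType}.
Variables (P : probability Omega R) (P' : probability Omega' R).
Variables (X : Omega -> R) (X' : Omega' -> R).
Hypotheses (mX : measurable_fun setT X) (mX' : measurable_fun setT X').
Hypothesis lawX : law_eq P P' X X'.

Lemma law_eq_ge0_integral (g : R -> \bar R) :
  measurable_fun setT g -> (forall x, 0 <= g x)%E ->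
  (\int[P]_w g (X w) = \int[P']_w g (X' w))%E.
Proof.
move=> mg g0; have pushE := ge0_integral_pushforward _ _ measurableT mg (fun x _ => g0 x).
rewrite -[LHS](pushE _ _ _ mX P) -[RHS](pushE _ _ _ mX' P').
by apply: eq_measure_integral => A mA _; exact: lawX.
Qed.

Lemma law_eq_has_mean (g : R -> R) a : measurable_fun setT g ->
  has_mean P (fun w => g (X w)) a -> has_mean P' (fun w => g (X' w)) a.
Proof.
move=> mg [gX_int <-].
have mEg : measurable_fun setT (EFin \o g) by exact/measurable_EFinP.
have gX'_int : P'.-integrable setT ((EFin \o g) \o X').
  apply/integrableP; split; first exact: measurableT_comp.
  have <- := law_eq_ge0_integral (g := abse \o (EFin \o g)) (measurableT_comp _ mEg).
  - by move/integrableP : gX_int => [].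
  - exact: abse_measurable.
  - by move=> x /=.
split=> //; congr fine.
transitivity (\int[pushforward P X]_x (EFin \o g) x)%E; last first.
  by rewrite integral_pushforward.
transitivity (\int[pushforward P' X']_x (EFin \o g) x)%E.
  by rewrite integral_pushforward.
by apply: eq_measure_integral => A mA _; exact/esym/lawX.
Qed.

Lemma law_eq_ae (A : set R) : measurable A ->
  {ae P, forall w, A (X w)} -> {ae P', forall w, A (X' w)}.
Proof.
move=> mA [N [mN N0 subN]].
have mXA := preimage_measurable mX (measurableC mA).
have mXA' := preimage_measurable mX' (measurableC mA).
exists (X' @^-1` (~` A)); split => //.
by rewrite -lawX; [exact: subset_measure0 N0|exact: measurableC].
Qed.

End law_eq.

(** * Independence *)

Section product_measure_mul.
Context d1 d2 (T1 : measurableType d1) (T2 : measurableType d2) (R : realType).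
Variables (m1 : {sigma_finite_measure set T1 -> \bar R})
  (m2 : {sigma_finite_measure set T2 -> \bar R}) (f : T1 -> R) (g : T2 -> R).
Hypotheses (f_int : m1.-integrable setT (EFin \o f))
  (g_int : m2.-integrable setT (EFin \o g)).
Local Open Scope ereal_scope.

Lemma integrable_prod_mul :
  (m1 \x m2).-integrable setT (fun z => (f z.1 * g z.2)%:E).
Proof.
have [/measurable_EFinP mf f_fin] := integrableP _ _ _ f_int.
have [/measurable_EFinP mg g_fin] := integrableP _ _ _ g_int.
have mfabs : measurable_fun setT (fun x => `|f x|%:E).
  by apply/measurable_EFinP; exact: measurableT_comp.
have mgabs : measurable_fun setT (fun y => `|g y|%:E).
  by apply/measurable_EFinP; exact: measurableT_comp.
apply/integrable12ltyP.
  apply/measurable_EFinP/measurable_funM.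
    exact: (measurableT_comp mf measurable_fst).
  exact: (measurableT_comp mg measurable_snd).
have -> : \int[m1]_x \int[m2]_y `|(f x * g y)%:E| =
          \int[m1]_x (`|f x|%:E * \int[m2]_y `|g y|%:E).
  apply: eq_integral => x _; rewrite -ge0_integralZl//.
  by apply: eq_integral => y _ /=; rewrite normrM EFinM.
rewrite ge0_integralZr//; last exact: integral_ge0.
by apply: lte_mul_pinfty => //; [exact: integral_ge0|
  rewrite ge0_fin_numE//; exact: integral_ge0].
Qed.

Lemma integral_prod_mul :
  \int[m1 \x m2]_z (f z.1 * g z.2)%:E = \int[m1]_x (f x)%:E * \int[m2]_y (g y)%:E.
Proof.
rewrite -integral12_prod_meas1; last exact: integrable_prod_mul.
rewrite -[X in _ * X]fineK ?integrable_fin_num// -integralZr//.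
rewrite fineK ?integrable_fin_num//.
by apply: eq_integral => x _; rewrite /fubini_F/= -integralZl.
Qed.

End product_measure_mul.

Section independent_product.
Context {d : measure_display} {Omega : measurableType d} {R : realType}.
Variable P : probability Omega R.

Lemma has_mean_mul_indep (F G : set (set Omega)) f g a b :
  indep_sigma P F G -> measurable_wrt F f -> measurable_wrt G g ->
  has_mean P f a -> has_mean P g b -> has_mean P (fun w => f w * g w) (a * b).
Proof.
move=> indFG Ff Gg fa gb; have [[f_int <-] [g_int <-]] := (fa, gb).
have mf := has_mean_measurable fa; have mg := has_mean_measurable gb.
have mfg : measurable_fun setT (fun w => (f w, g w)) by exact/measurable_fun_pairP.
pose X : {RV P >-> R} := HB.pack f (isMeasurableFun.Build _ _ _ _ _ mf).
pose Y : {RV P >-> R} := HB.pack g (isMeasurableFun.Build _ _ _ _ _ mg).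
pose XY : {RV P >-> (R * R)%type} :=
  HB.pack (fun w => (f w, g w)) (isMeasurableFun.Build _ _ _ _ _ mfg).
pose mX : probability R R := distribution P X.
pose mY : probability R R := distribution P Y.
have prodE A : measurable A -> (mX \x mY)%E A = distribution P XY A.
  by apply: product_measure_unique => B C mB mC; apply: indFG; [exact: Ff|exact: Gg].
have mmul : measurable_fun setT (fun z : R * R => (z.1 * z.2)%:E).
  by apply/measurable_EFinP; exact: measurable_funM.
have X_int : mX.-integrable setT (EFin \o id).
  by apply: integrable_pushforward => //; exact/measurable_EFinP.
have Y_int : mY.-integrable setT (EFin \o id).
  by apply: integrable_pushforward => //; exact/measurable_EFinP.
have fg_int : P.-integrable setT (EFin \o (fun w => f w * g w)).
  have := integrable_prod_mul X_int Y_int; move/integrableP => [_].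
  rewrite (eq_measure_integral (distribution P XY)) => [|A mA _]; last exact: prodE.
  rewrite ge0_integral_distribution//; last exact: measurableT_comp.
  by move=> fg_fin; apply/integrableP; split => //; exact/measurable_EFinP/measurable_funM.
split => //; rewrite /Rintegral -fineM ?integrable_fin_num//; congr fine.
have := integral_prod_mul X_int Y_int.
rewrite (eq_measure_integral (distribution P XY)) => [|A mA _]; last exact: prodE.
by rewrite !integral_distribution.
Qed.

End independent_product.

Section generated_sigma_algebra.
Context {d : measure_display} {Omega : measurableType d} {R : realType}.
Implicit Types (Xs : set (Omega -> R)) (f : Omega -> R).

Definition preimages Xs : set (set Omega) :=
  [set A | exists2 X, Xs X & exists2 B : set R, measurable B & A = X @^-1` B].

Lemma sigma_genS Xs Ys : Xs `<=` Ys -> sigma_gen Xs `<=` sigma_gen Ys.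
Proof.
move=> XY; apply: smallest_sub; first exact: smallest_sigma_algebra.
by move=> A [X XX preA]; apply: sub_sigma_algebra; exists X => //; exact: XY.
Qed.

Lemma sigma_gen_measurable Xs : (forall X, Xs X -> measurable_fun setT X) ->
  sigma_gen Xs `<=` measurable.
Proof.
move=> mXs; apply: smallest_sub; first exact: sigma_algebra_measurable.
by move=> _ [X XX [B mB ->]]; apply: preimage_measurable => //; exact: mXs.
Qed.

End generated_sigma_algebra.

(* [measurable_wrt (sigma_gen Xs) f], as an instance of the library's [measurable_fun] *)
Notation sigma_measurable Xs f :=
  (measurable_fun [set: g_sigma_algebraType (preimages Xs)]
    (f : g_sigma_algebraType (preimages Xs) -> _)).

Section sigma_measurable.
Context {d : measure_display} {Omega : measurableType d} {R : realType}.
Implicit Types (Xs : set (Omega -> R)) (f : Omega -> R).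

Lemma sigma_measurableP Xs f :
  measurable_wrt (sigma_gen Xs) f <-> sigma_measurable Xs f.
Proof.
split=> [mf _ B mB|mf B mB]; first by rewrite setTI; exact: mf.
by have := mf measurableT B mB; rewrite setTI.
Qed.

Lemma sigma_measurable_gen Xs f : Xs f -> sigma_measurable Xs f.
Proof.
move=> Xf; apply/sigma_measurableP => B mB.
by apply: sub_sigma_algebra; exists f => //; exists B.
Qed.

Lemma sigma_measurableS Xs Ys f :
  Xs `<=` Ys -> sigma_measurable Xs f -> sigma_measurable Ys f.
Proof.
move=> XY /sigma_measurableP mf; apply/sigma_measurableP => B mB.
exact: sigma_genS XY _ (mf B mB).
Qed.

Lemma sigma_measurable_fun Xs f : (forall X, Xs X -> measurable_fun setT X) ->
  sigma_measurable Xs f -> measurable_fun setT f.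
Proof.
move=> mXs /sigma_measurableP mf _ B mB; rewrite setTI.
exact: sigma_gen_measurable mXs _ (mf B mB).
Qed.

End sigma_measurable.

Lemma measurable_fun_natrb d (T : measurableType d) (R : realType) (b : T -> bool) :
  measurable_fun setT b -> measurable_fun setT (fun x => (b x)%:R : R).
Proof.
move=> mb; rewrite (_ : (fun x => _) = fun x => if b x then 1 else 0).
  exact: measurable_fun_ifT.
by apply/funext => x; case: (b x).
Qed.

Section independence.
Context {d : measure_display} {Omega : measurableType d} {R : realType}.
Variable P : probability Omega R.

Lemma indep_sigma_sym (F G : set (set Omega)) : indep_sigma P F G -> indep_sigma P G F.
Proof. by move=> FG A B GA FB; rewrite setIC muleC; exact: FG. Qed.

Lemma indep_sigmaS (F F' G G' : set (set Omega)) :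
  F `<=` F' -> G `<=` G' -> indep_sigma P F' G' -> indep_sigma P F G.
Proof. by move=> FF' GG' ind A B /FF' FA /GG' GB; exact: ind. Qed.

Lemma indep_sigma_cst (k : R) (F : set (set Omega)) :
  indep_sigma P (sigma_gen [set (fun=> k)]) F.
Proof.
have trivial : sigma_gen [set (fun _ : Omega => k)] `<=` [set set0; setT].
  apply: smallest_sub.
    split; first by left.
    - by move=> A [->|->]; [right; rewrite setD0|left; rewrite setDv].
    - move=> A A0T; have [[n AnT]|AnT] := pselect (exists n, A n = setT).
        by right; apply/seteqP; split => // x _; exists n => //; rewrite AnT.
      left; apply/seteqP; split => // x [n _]; case: (A0T n) => [->//|AnE].
      by exfalso; apply: AnT; exists n.
  move=> _ [_ -> [B mB ->]]; have [Bk|Bk] := pselect (B k).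
    by right; apply/seteqP; split.
  by left; apply/seteqP; split.
move=> A B /trivial[->|->] _; first by rewrite set0I measure0 mul0e.
by rewrite setTI probability_setT mul1e.
Qed.

Lemma indep_sigma_g_sigmal (G F : set (set Omega)) :
  G `<=` measurable -> F `<=` measurable -> setI_closed G -> G setT ->
  indep_sigma P G F -> indep_sigma P <<s G >> F.
Proof.
move=> mG mF IG TG indGF A B sA FB; have mB := mF _ FB.
have PB0 : 0 <= fine (P B) by rewrite fine_ge0.
rewrite -[P B]fineK ?fin_num_measure// muleC.
pose restr : {measure set Omega -> \bar R} := mrestr P mB.
pose scaled : {measure set Omega -> \bar R} := mscale (NngNum PB0) P.
apply: (@g_sigma_algebra_measure_unique _ _ _ G mG (fun=> setT) _ _ restr scaled) => //.
- by rewrite bigcup_const//; exists 0%N.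
- by move=> C GC /=; rewrite /mrestr /mscale/= indGF// fineK ?fin_num_measure// muleC.
- move=> _; rewrite /= /mrestr; apply: (@le_lt_trans _ _ (P setT)).
    by apply: le_measure; rewrite ?inE//; exact: measurableI.
  by rewrite probability_setT ltry.
Qed.

Lemma indep_sigma_g_sigma (G F : set (set Omega)) :
  G `<=` measurable -> F `<=` measurable -> setI_closed G -> setI_closed F ->
  G setT -> F setT -> indep_sigma P G F -> indep_sigma P <<s G >> <<s F >>.
Proof.
move=> mG mF IG IF TG TF indGF.
have msF : <<s F >> `<=` @measurable _ Omega.
  by apply: smallest_sub => //; exact: sigma_algebra_measurable.
apply: indep_sigma_g_sigmal => //; apply: indep_sigma_sym.
by apply: indep_sigma_g_sigmal => //; exact: indep_sigma_sym.
Qed.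

End independence.

Section mutually_independent.
Context {d : measure_display} {Omega : measurableType d} {R : realType} {I : eqType}.
Variables (P : probability Omega R) (X : I -> Omega -> R).
Hypotheses (mX : forall i, measurable_fun setT (X i)) (indX : mutually_independent P X).

Lemma mutually_independent_comp (h : I -> R -> R) :
  (forall i, measurable_fun setT (h i)) ->
  mutually_independent P (fun i w => h i (X i w)).
Proof.
move=> mh J B uJ mB; apply: (indX (B := fun i => h i @^-1` B i)) => // i.
exact: preimage_measurable.
Qed.

Definition cylinders (J : set I) : set (set Omega) :=
  [set A | exists (s : seq I) (B : I -> set R),
    [/\ uniq s, (forall i, i \in s -> J i), (forall i, measurable (B i)) &
        A = \big[setI/setT]_(i <- s) (X i @^-1` B i)]].

Lemma bigsetI_preimageE (s : seq I) (B : I -> set R) :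
  \big[setI/setT]_(i <- s) (X i @^-1` B i) = [set w | forall i, i \in s -> B i (X i w)].
Proof.
elim: s => [|i s IHs]; first by rewrite big_nil; apply/seteqP; split.
rewrite big_cons IHs; apply/seteqP; split => w /=.
  by move=> [Bi Bs] j; rewrite inE => /orP[/eqP ->//|]; exact: Bs.
by move=> Bis; split=> [|j js]; apply: Bis; rewrite inE ?eqxx// js orbT.
Qed.

Lemma cylinders_measurable J : cylinders J `<=` measurable.
Proof.
move=> _ [s [B [_ _ mB ->]]]; apply: bigsetI_measurable => i _.
exact: preimage_measurable.
Qed.

Lemma cylindersI J : setI_closed (cylinders J).
Proof.
move=> _ _ [s [B [us sJ mB ->]]] [t [C [ut tJ mC ->]]].
exists (undup (s ++ t)), (fun i => (if i \in s then B i else setT) `&`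
                                   (if i \in t then C i else setT)).
split; first exact: undup_uniq.
- by move=> i; rewrite mem_undup mem_cat => /orP[/sJ|/tJ].
- by move=> i; apply: measurableI; case: ifP.
rewrite !bigsetI_preimageE; apply/seteqP; split => w /=.
  by move=> [Bs Ct] i _; split; case: ifPn => // ?; [exact: Bs|exact: Ct].
move=> BC; split => i ij; have := BC i; rewrite mem_undup mem_cat ij.
  by move=> /(_ isT)[].
by rewrite orbT => /(_ isT)[].
Qed.

Lemma cylindersT J : cylinders J setT.
Proof. by exists [::], (fun=> setT); split => //; rewrite big_nil. Qed.

Lemma sub_sigma_gen_cylinders J :
  sigma_gen [set f | exists2 i, J i & f = X i] `<=` <<s cylinders J >>.
Proof.
apply: smallest_sub; first exact: smallest_sigma_algebra.
move=> _ [_ [i Ji ->] [B mB ->]]; apply: sub_sigma_algebra.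
exists [:: i], (fun=> B); split => //; last by rewrite big_seq1.
by move=> j; rewrite inE => /eqP ->.
Qed.

Lemma indep_cylinders J K : J `&` K = set0 ->
  indep_sigma P (cylinders J) (cylinders K).
Proof.
move=> JK0 A A' cA cA'.
have mA := cylinders_measurable cA; have mA' := cylinders_measurable cA'.
case: cA => s [B [us sJ mB AE]]; case: cA' => t [C [ut tJ mC A'E]].
have st i : i \in s -> i \in t -> False.
  by move=> /sJ Ji /tJ Ki; have : (J `&` K) i by []; rewrite JK0.
pose BC i := if i \in s then B i else C i.
have mBC i : measurable (BC i) by rewrite /BC; case: ifP.
have {}AE : A = \big[setI/setT]_(i <- s) (X i @^-1` BC i).
  by rewrite AE; apply: eq_big_seq => i si; rewrite /BC si.
have {}A'E : A' = \big[setI/setT]_(i <- t) (X i @^-1` BC i).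
  by rewrite A'E; apply: eq_big_seq => i ti; rewrite /BC; case: ifPn => // /st/(_ ti).
have ust : uniq (s ++ t).
  by rewrite cat_uniq us ut andbT/=; apply/hasPn => i ti; apply/negP => /st; exact.
have := indX ust mBC; rewrite !big_cat/= -(indX us mBC) -(indX ut mBC) -AE -A'E => PAA'.
rewrite -[LHS]fineK ?fin_num_measure//; last exact: measurableI.
by rewrite PAA' EFinM !fineK ?fin_num_measure.
Qed.

Lemma mutually_independent_blocks J K : J `&` K = set0 ->
  indep_sigma P (sigma_gen [set f | exists2 i, J i & f = X i])
                (sigma_gen [set f | exists2 i, K i & f = X i]).
Proof.
move=> JK0; apply: indep_sigmaS (@sub_sigma_gen_cylinders J)
  (@sub_sigma_gen_cylinders K) _.
apply: indep_sigma_g_sigma (indep_cylinders JK0).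
- exact: cylinders_measurable.
- exact: cylinders_measurable.
- exact: cylindersI.
- exact: cylindersI.
- exact: cylindersT.
- exact: cylindersT.
Qed.

Lemma mutually_independent_adjoin (U : Omega -> R) : measurable_fun setT U ->
  indep_sigma P (sigma_gen [set U]) (sigma_gen [set f | exists i, f = X i]) ->
  mutually_independent P (fun o => if o is Some i then X i else U).
Proof.
move=> mU indUX J B uJ mB; pose s := pmap id J.
have Some_inj : injective (@Some I) by move=> ? ? [].
have us : uniq (map Some s).
  by rewrite map_inj_uniq//; apply: (pmap_uniq (g := Some)) => // -[].
have mem_s o : (o \in map Some s) = (o != None) && (o \in J).
  case: o => [i|]; first by rewrite mem_map// mem_pmap map_id.
  by apply/negbTE/negP => /mapP[].
pose XB := \big[setI/setT]_(i <- s) (X i @^-1` B (Some i)).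
have PXB : fine (P XB) = \prod_(i <- s) fine (P (X i @^-1` B (Some i))).
  by apply: (indX (B := fun i => B (Some i))) => //; rewrite -(map_inj_uniq Some_inj).
have [JN|JN] := boolP (None \in J); last first.
  have pJ : perm_eq J (map Some s).
    by apply: uniq_perm => // -[i|]; rewrite mem_s//; exact/negbTE.
  by rewrite !(perm_big _ pJ)/= !big_map.
have pJ : perm_eq J (None :: map Some s).
  apply: uniq_perm => //; first by rewrite /= us mem_s.
  by move=> [i|]; rewrite inE mem_s//= JN.
rewrite !(perm_big _ pJ)/= !big_cons !big_map/= -/XB -PXB indUX ?fineM// ?fin_num_measure//.
- exact: preimage_measurable.
- by apply: bigsetI_measurable => i _; exact: preimage_measurable.
- by apply: sub_sigma_algebra; exists U => //; exists (B None).
- apply: (@bigsetI_measurable _ (g_sigma_algebraType (preimages [set f | exists i, f = X i]))).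
  move=> i _; apply: sub_sigma_algebra; exists (X i); first by exists i.
  by exists (B (Some i)).
Qed.

End mutually_independent.

(** * The relative value function *)

Section sqr_excess.
Context {R : realType}.
Implicit Types x y : R.

Definition sqr_excess y x : R := Num.max (x - y) 0 ^+ 2.

Lemma sqr_excess_le y x : 0 <= sqr_excess y x <= 2 * x ^+ 2 + 2 * y ^+ 2.
Proof.
rewrite sqr_ge0/=; have := sqr_ge0 (x + y); have := sqr_ge0 x; have := sqr_ge0 y.
by rewrite /sqr_excess !expr2; have [?|?] := leP (x - y) 0 => *; lra.
Qed.

Lemma sqr_excess_le_sqr y x : 0 <= y -> sqr_excess y x <= x ^+ 2.
Proof.
move=> y0; have := sqr_ge0 x; rewrite /sqr_excess.
have [_|yx ?] := leP (x - y) 0; first by rewrite expr0n.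
by apply: lerXn2r; rewrite ?nnegrE; lra.
Qed.

Lemma measurable_sqr_excess y : measurable_fun setT (sqr_excess y).
Proof. by apply: measurable_funX; apply: measurable_maxr => //; exact: measurable_funB. Qed.

Lemma continuous_sqr_excess x : continuous (sqr_excess ^~ x).
Proof.
move=> y; have excess_cont : {for y, continuous ((fun z => x - z) \max (fun=> 0 : R))}.
  apply: continuous_max; last exact: cst_continuous.
  by apply: cvgB; [exact: cvg_cst|exact: cvg_id].
exact: (cvgM excess_cont excess_cont).
Qed.

End sqr_excess.

Section relative_value.
Context {R : realType}.
Variables (theta c : R).
Hypotheses (theta0 : 0 <= theta) (c0 : 0 <= c).
Local Notation beta := (theta + c).

(* The part of the expected future cost, net of the cost rate [beta], that depends on
   the age [x] just after a delivery, under the rule "wait until the age is [theta]". *)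
Definition relval (x : R) : R :=
  sqr_excess theta x / 2 - x ^+ 2 / 2 + beta * x.

Lemma measurable_relval : measurable_fun setT relval.
Proof.
apply: measurable_funD; last exact: measurable_funM.
apply: measurable_funB; apply: measurable_funM => //.
exact: measurable_sqr_excess.
Qed.

Lemma relval0 : relval 0 = 0.
Proof.
rewrite /relval /sqr_excess max_r ?sub0r ?oppr_le0//.
by rewrite expr0n/= !mul0r mulr0 subrr addr0.
Qed.

Lemma relval_ge0 x : 0 <= x -> 0 <= relval x.
Proof.
move=> x0; have := mulr_ge0 c0 x0; rewrite /relval /sqr_excess !expr2.
have [x_theta|theta_x] := leP (x - theta) 0 => cx0.
  have : 0 <= x * (theta - x) by apply: mulr_ge0 => //; lra.
  have := mulr_ge0 x0 theta0; lra.
by have := sqr_ge0 theta; rewrite expr2; lra.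
Qed.

Lemma relval_le x : 0 <= x -> relval x <= (theta ^+ 2 + beta ^+ 2) / 2 + c * x.
Proof.
move=> x0; have := mulr_ge0 c0 x0; have := sqr_ge0 (x - beta).
have := sqr_ge0 theta; have := sqr_ge0 beta.
by rewrite /relval /sqr_excess !expr2; have [_|_] := leP (x - theta) 0 => ? ? ? ?; lra.
Qed.

Lemma sqr_sub_excess_le b M : 0 <= b <= M -> `|b ^+ 2 - sqr_excess theta b| <= M ^+ 2.
Proof.
move=> /andP[b0 bM]; have excess_le := sqr_excess_le_sqr b theta0.
have : b ^+ 2 <= M ^+ 2 by apply: lerXn2r; rewrite ?nnegrE//; exact: le_trans bM.
rewrite ger0_norm ?subr_ge0//; apply: le_trans.
by rewrite gerBl; case/andP: (sqr_excess_le theta b).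
Qed.

(* Age [a] at a delivery and [b] at the next sampling time; that sample takes time [y]
   and is received iff [s]. *)
Definition drift (s : bool) (a b y : R) : R :=
  ((b + y) ^+ 2 - a ^+ 2) / 2 - beta * (b - a + y)
  + relval (if s then y else b + y) - relval a.

Definition drift_slope (s : bool) (y : R) : R := y - beta * s%:R.

Definition drift_intercept (s : bool) (y : R) : R :=
  y ^+ 2 / 2 - theta * y + s%:R * (relval y - c * y).

(* A lower bound of [drift] that is free of [a] and a sum of products of a function of
   [b], known before the transmission, and one of its outcome [(s, y)]. *)
Definition drift_bound (s : bool) (b y : R) : R :=
  (b ^+ 2 - sqr_excess theta b) * (s%:R / 2) + b * drift_slope s y + drift_intercept s y.

Lemma drift_bound_le s a b y : 0 <= y -> a <= b -> drift_bound s b y <= drift s a b y.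
Proof.
move=> y0 ab; rewrite /drift /drift_bound /drift_slope /drift_intercept.
have excess_a : sqr_excess theta a <= sqr_excess theta b.
  by apply: lerXn2r; rewrite ?nnegrE;
    have [?|?] := leP (a - theta) 0; have [?|?] := leP (b - theta) 0; lra.
have excess_by : y ^+ 2 + 2 * y * (b - theta) + sqr_excess theta b
    <= sqr_excess theta (b + y).
  rewrite /sqr_excess; have [b_theta|theta_b] := leP (b - theta) 0;
    have [by_theta|theta_by] := leP (b + y - theta) 0.
  - have : 0 <= y * (theta - (b + y)) by apply: mulr_ge0 => //; lra.
    have : 0 <= y * (theta - b) by apply: mulr_ge0 => //; lra.
    by rewrite !expr2; lra.
  - by have := sqr_ge0 (b - theta); rewrite !expr2; lra.
  - lra.
  - by rewrite !expr2; lra.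
by case: s => /=; rewrite /relval; lra.
Qed.

Lemma drift_bound_threshold s a y : 0 <= y ->
  drift_bound s (Num.max a theta) y = drift s a (Num.max a theta) y.
Proof.
move=> y0; rewrite /drift /drift_bound /drift_slope /drift_intercept /relval /sqr_excess.
have [a_theta|theta_a] := leP a theta.
  rewrite subrr maxxx (max_r (_ : a - theta <= 0)); last by lra.
  have excess_y : Num.max (theta + y - theta) 0 = y by rewrite addrAC subrr add0r max_l.
  by case: s => /=; rewrite ?excess_y; field.
rewrite (max_l (_ : 0 <= a - theta)); last by lra.
have excess_ay : Num.max (a + y - theta) 0 = a + y - theta by rewrite max_l//; lra.
by case: s => /=; rewrite ?excess_ay; field.
Qed.

Definition crossing_const (delta : R) : R :=
  (1 + c ^+ 2) / delta + 1 + c ^+ 2 + theta ^+ 2 + beta ^+ 2.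

Lemma crossing_const_ge0 delta : 0 < delta -> 0 <= crossing_const delta.
Proof.
move=> delta0; rewrite /crossing_const !addr_ge0 ?sqr_ge0//.
by rewrite divr_ge0 ?addr_ge0 ?sqr_ge0// ltW.
Qed.

(* The slot from the delivery time [D] to the next one [D + z + y] contains the horizon
   [T]; the cost [G] is accrued up to [D], where the age is [a], and [A] is the age at [T].
   The overshoot is of order [A * y], absorbed by [A ^+ 2 / 2 <= G + (A ^+ 2 - a ^+ 2) / 2]. *)
Lemma crossing_drift_le (s : bool) (delta G D T a z y A : R) :
  0 < delta -> 0 <= a -> 0 <= z -> 0 <= y -> D <= T < D + z + y ->
  a ^+ 2 / 2 <= G -> A = a + (T - D) ->
  G - beta * D + relval a + drift s a (a + Num.min z (T - D)) y <=
  (1 + delta) * (G + (A ^+ 2 - a ^+ 2) / 2) - beta * T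
  + crossing_const delta * (1 + y ^+ 2).
Proof.
move=> delta0 a0 z0 y0 /andP[DT TDzy] aG AE; have theta_ge0 := theta0; have c_ge0 := c0.
set b := a + Num.min z (T - D).
have A_ge0 : 0 <= A by lra.
have b_A : b <= A by rewrite AE lerD2l ge_min lexx orbT.
have a_b : a <= b by rewrite lerDl le_min z0 subr_ge0.
have T_crossed : T <= D + (b - a) + y.
  by rewrite /b; have [_|_] := leP z (T - D); lra.
have byA : (b + y) ^+ 2 <= (A + y) ^+ 2 by apply: lerXn2r; rewrite ?nnegrE; lra.
have beta_T : beta * T <= beta * (D + (b - a) + y) by apply: ler_wpM2l => //; lra.
set next := if s then y else b + y.
have next_ge0 : 0 <= next by rewrite /next; case: ifP => _; lra.
have next_le : c * next <= c * (A + y).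
  by apply: ler_wpM2l => //; rewrite /next; case: ifP => _; lra.
have young : A * (y + c) <= delta * (A ^+ 2 / 2) + (y ^+ 2 + c ^+ 2) / delta.
  have : 0 <= (delta * A - (y + c)) ^+ 2 / (2 * delta) + (y - c) ^+ 2 / (2 * delta).
    by rewrite addr_ge0// divr_ge0 ?sqr_ge0// mulr_ge0// ltW.
  rewrite (_ : _ / _ + _ = delta * (A ^+ 2 / 2) - A * (y + c) + (y ^+ 2 + c ^+ 2) / delta).
    lra.
  by field; rewrite gt_eqF.
have cost_A : delta * (A ^+ 2 / 2) <= delta * (G + (A ^+ 2 - a ^+ 2) / 2).
  by rewrite ler_pM2l//; lra.
have const_le : (y ^+ 2 + c ^+ 2) / delta + c * y + y ^+ 2 / 2 + (theta ^+ 2 + beta ^+ 2) / 2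
    <= crossing_const delta * (1 + y ^+ 2).
  have := sqr_ge0 (c - y); have := sqr_ge0 c; have := sqr_ge0 theta; have := sqr_ge0 beta.
  have y2 := sqr_ge0 y; have c2y2 := mulr_ge0 (sqr_ge0 c) y2.
  have := mulr_ge0 (sqr_ge0 theta) y2; have := mulr_ge0 (sqr_ge0 beta) y2.
  have : 0 <= (1 + c ^+ 2 * y ^+ 2) / delta by rewrite divr_ge0 ?addr_ge0// ltW.
  rewrite (_ : crossing_const delta * _ =
    (y ^+ 2 + c ^+ 2) / delta + (1 + c ^+ 2 * y ^+ 2) / delta
    + (1 + c ^+ 2 + theta ^+ 2 + beta ^+ 2) * (1 + y ^+ 2)).
    by rewrite mulrDl mulrDr !mulr1 !expr2; lra.
  by rewrite /crossing_const; field; rewrite gt_eqF.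
have := relval_le next_ge0; rewrite /drift -/next.
rewrite (_ : (A + y) ^+ 2 = A ^+ 2 + 2 * (A * y) + y ^+ 2) in byA; last by ring.
lra.
Qed.

Lemma crossing_cost_le (s : bool) (G D T a z y A : R) :
  0 <= a -> 0 <= z <= theta -> 0 <= y -> D <= T < D + z + y ->
  A = a + (T - D) ->
  G + (A ^+ 2 - a ^+ 2) / 2 <=
  G - beta * D + relval a + drift s a (a + z) y + beta * T + beta * (theta + 1 + y ^+ 2).
Proof.
move=> a0 /andP[z0 z_theta] y0 /andP[DT TDzy] AE; have theta_ge0 := theta0; have c_ge0 := c0.
have A2_le : A ^+ 2 <= (a + z + y) ^+ 2.
  by apply: lerXn2r; rewrite ?nnegrE; lra.
set next := if s then y else a + z + y.
have next_ge0 : 0 <= next by rewrite /next; case: ifP => _; lra.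
have y_le : y <= 1 + y ^+ 2 by have := sqr_ge0 (y - 1); have := sqr_ge0 y; rewrite !expr2; lra.
have : beta * (D + z + y) <= beta * (T + (theta + 1 + y ^+ 2)) by apply: ler_wpM2l; lra.
by have := relval_ge0 next_ge0; rewrite /drift -/next; lra.
Qed.

End relative_value.

(** * Sample paths *)

Section dynamics.
Context {d : measure_display} {Omega : measurableType d} {R : realType}.
Variables (Y : nat -> Omega -> R) (succ : nat -> Omega -> bool).
Variable pi : policy (Omega := Omega) (R := R).
Implicit Types (T : R) (n i : nat) (w : Omega).
Local Notation D := (deliv Y pi).

(* The sampling time written S_{\underline i} in the paper *)
Fixpoint fresh_samp i w : R :=
  if i is j.+1 then (if succ j.+1 w then samp Y pi j.+1 w else fresh_samp j w) else 0.

Definition deliv_age i w : R := D i w - fresh_samp i w.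
Local Notation L := fresh_samp.
Local Notation A := deliv_age.

Definition reached T i w : R := (D i w <= T)%R%:R.

Definition stopped_sum T n (f : nat -> Omega -> R) w : R :=
  \sum_(i < n) reached T i w * f i w.

Definition slot_cost T i w : R := ((Num.min (D i.+1 w) T - L i w) ^+ 2 - A i w ^+ 2) / 2.

Definition path_cost T n w : R := stopped_sum T n (slot_cost T) w.

Definition overshoot T n w : R :=
  stopped_sum T n (fun i w => (T < D i.+1 w)%R%:R * Y i.+1 w ^+ 2) w.

Definition drift_sum theta c (b : nat -> Omega -> R) T n w : R :=
  stopped_sum T n (fun i w => drift theta c (succ i.+1 w) (A i w) (b i w) (Y i.+1 w)) w.

Definition capped_age T i w : R := A i w + Num.min (pol_Z pi i w) (T - D i w).

Definition waits_until theta w : Prop :=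
  forall i, pol_Z pi i w = Num.max (theta - A i w) 0.

Definition deliv_cost m w : R :=
  \sum_(i < m) ((D i.+1 w - L i w) ^+ 2 - A i w ^+ 2) / 2.

Lemma delivS i w : D i.+1 w = D i w + pol_Z pi i w + Y i.+1 w. Proof. by []. Qed.

Lemma deliv_ageS i w :
  A i.+1 w = if succ i.+1 w then Y i.+1 w else A i w + pol_Z pi i w + Y i.+1 w.
Proof. by rewrite /A/=; case: ifP => _; ring. Qed.

Lemma deliv_age0 w : A 0%N w = 0. Proof. exact: subrr. Qed.

Section path.
Variables (eps : R) (w : Omega).
Hypotheses (eps0 : 0 < eps) (Y_ge_eps : forall i, eps <= Y i.+1 w).
Hypothesis Z_ge0 : forall i, 0 <= pol_Z pi i w.

Lemma time_ge0 i : 0 <= Y i.+1 w.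
Proof. exact: le_trans (ltW eps0) (Y_ge_eps i). Qed.

Lemma deliv_leS i : D i w <= D i.+1 w.
Proof. by rewrite delivS; have := Z_ge0 i; have := time_ge0 i; lra. Qed.

Lemma deliv_nondecreasing i j : (i <= j)%N -> D i w <= D j w.
Proof. by move/(homo_leq (f := D ^~ w) lexx le_trans deliv_leS). Qed.

Lemma deliv_ge_muln i : i%:R * eps <= D i w.
Proof.
elim: i => [|i IHi]; first by rewrite mul0r.
by rewrite delivS -natr1 mulrDl mul1r; have := Z_ge0 i; have := Y_ge_eps i; lra.
Qed.

Lemma deliv_ge0 i : 0 <= D i w.
Proof. by apply: le_trans (deliv_ge_muln i); rewrite mulr_ge0// ltW. Qed.

Lemma fresh_samp_le_deliv i : L i w <= D i w.
Proof.
elim: i => [//|i IHi]; rewrite delivS/=.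
by have := Z_ge0 i; have := time_ge0 i; case: ifP => _; lra.
Qed.

Lemma fresh_samp_leS i : L i w <= L i.+1 w.
Proof.
by rewrite /=; case: ifP => // _; have := fresh_samp_le_deliv i; have := Z_ge0 i; lra.
Qed.

Lemma fresh_samp_ge0 i : 0 <= L i w.
Proof. by elim: i => [//|i]; move/le_trans; apply; exact: fresh_samp_leS. Qed.

Lemma deliv_age_ge0 i : 0 <= A i w.
Proof. by rewrite subr_ge0 fresh_samp_le_deliv. Qed.

Lemma deliv_age_le_deliv i : A i w <= D i w.
Proof. by rewrite gerBl fresh_samp_ge0. Qed.

Lemma deliv_age_sqr_le_deliv_cost m : A m w ^+ 2 / 2 <= deliv_cost m w.
Proof.
elim: m => [|m IHm]; first by rewrite /deliv_cost big_ord0 deliv_age0 expr0n mul0r.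
rewrite /deliv_cost big_ord_recr/= -/(deliv_cost m w).
have : A m.+1 w ^+ 2 <= (D m.+1 w - L m w) ^+ 2.
  have := deliv_age_ge0 m.+1; have := fresh_samp_leS m.
  by rewrite /A => ? ?; apply: lerXn2r; rewrite ?nnegrE; lra.
by move: IHm; rewrite delivS; lra.
Qed.

Lemma slot_cost_bounded T i : D i w <= T -> `|slot_cost T i w| <= T ^+ 2.
Proof.
move=> DT; have min_T : Num.min (D i.+1 w) T <= T by rewrite ge_min lexx orbT.
have D_min : D i w <= Num.min (D i.+1 w) T by rewrite le_min deliv_leS.
have := fresh_samp_ge0 i; have := fresh_samp_le_deliv i; have := deliv_age_ge0 i.
have := deliv_age_le_deliv i => age_D age0 L_D L0.
have : (Num.min (D i.+1 w) T - L i w) ^+ 2 <= T ^+ 2 by apply: lerXn2r; rewrite ?nnegrE; lra.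
have : A i w ^+ 2 <= T ^+ 2 by apply: lerXn2r; rewrite ?nnegrE; lra.
have := sqr_ge0 (Num.min (D i.+1 w) T - L i w); have := sqr_ge0 (A i w).
by rewrite /slot_cost ler_norml => ? ? ? ?; apply/andP; split; lra.
Qed.

Lemma capped_age_bounds T i : D i w <= T -> 0 <= capped_age T i w <= T.
Proof.
move=> DT; have := deliv_age_ge0 i; have := deliv_age_le_deliv i; have := Z_ge0 i.
by rewrite /capped_age; have [?|?] := leP (pol_Z pi i w) (T - D i w); lra.
Qed.

Lemma sum_drift theta c (b : nat -> Omega -> R) m : 0 <= theta ->
  (forall i, (i < m)%N -> b i w = A i w + pol_Z pi i w) ->
  \sum_(i < m) drift theta c (succ i.+1 w) (A i w) (b i w) (Y i.+1 w) =
  deliv_cost m w - (theta + c) * D m w + relval theta c (A m w).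
Proof.
move=> theta0; elim: m => [|m IHm] bE.
  by rewrite /deliv_cost !big_ord0 deliv_age0 relval0// mulr0 subrr addr0.
rewrite /deliv_cost !big_ord_recr/= IHm; last by move=> i im; exact/bE/ltnW.
by rewrite bE// /drift -deliv_ageS -/(deliv_cost m w) /A; ring.
Qed.

Lemma crossing_exists T n : 0 <= T -> T < D n w ->
  exists2 m, (m < n)%N & D m w <= T < D m.+1 w.
Proof.
move=> T0; elim: n => [|n IHn] TD; first by move: TD; rewrite ltNge T0.
have [DT|{}TD] := leP (D n w) T; first by exists n => //; rewrite DT.
by have [m mn mE] := IHn TD; exists m => //; exact: ltnW.
Qed.

Section crossing.
Variables (T : R) (m n : nat).
Hypotheses (mn : (m < n)%N) (crossing : D m w <= T < D m.+1 w).

Lemma deliv_le_crossing i : (D i w <= T) = (i <= m)%N.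
Proof.
case/andP: crossing => DT TD; apply/idP/idP => [iT|im].
  rewrite leqNgt; apply/negP => /deliv_nondecreasing mi.
  by move: TD; rewrite ltNge (le_trans mi iT).
exact: le_trans (deliv_nondecreasing im) DT.
Qed.

Lemma stopped_sum_crossing f : stopped_sum T n f w = \sum_(i < m) f i w + f m w.
Proof.
transitivity (\sum_(i < m.+1) f i w); last by rewrite big_ord_recr.
rewrite (big_ord_widen _ (f ^~ w) mn) big_mkcond/=.
apply: eq_bigr => i _; rewrite /reached deliv_le_crossing ltnS.
by case: (i <= m)%N; rewrite ?mul1r ?mul0r.
Qed.

Lemma min_deliv_le_crossing i : (i < m)%N -> Num.min (D i.+1 w) T = D i.+1 w.
Proof. by move=> im; rewrite min_l// deliv_le_crossing. Qed.

Lemma path_cost_crossing :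
  path_cost T n w = deliv_cost m w + ((T - L m w) ^+ 2 - A m w ^+ 2) / 2.
Proof.
rewrite /path_cost stopped_sum_crossing; congr (_ + _).
  by apply: eq_bigr => i _; rewrite /slot_cost min_deliv_le_crossing.
by rewrite /slot_cost min_r//; case/andP: crossing => _ /ltW.
Qed.

Lemma overshoot_crossing : overshoot T n w = Y m.+1 w ^+ 2.
Proof.
rewrite /overshoot stopped_sum_crossing big1 => [|i _].
  by case/andP: crossing => _ ->; rewrite mul1r add0r.
by rewrite ltNge deliv_le_crossing ltn_ord mul0r.
Qed.

End crossing.

Definition tail_sqr (Q x : R) : R := if Q < x then x ^+ 2 else 0.

(* Only one term of [overshoot] is nonzero, so a sum over the slots is only needed for
   the part above the level [Q]: this makes the mean of [overshoot] sublinear in [T]. *)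
Lemma overshoot_le T n Q : 0 <= T -> T < D n w -> 0 <= Q ->
  overshoot T n w <= Q ^+ 2 + \sum_(i < n) tail_sqr Q (Y i.+1 w).
Proof.
move=> T0 TD Q0; have [m mn crossing] := crossing_exists T0 TD.
have tail_ge0 x : 0 <= tail_sqr Q x by rewrite /tail_sqr; case: ifP; rewrite ?sqr_ge0.
rewrite (overshoot_crossing mn crossing) (bigD1 (Ordinal mn))//= addrA.
have : 0 <= \sum_(i < n | i != Ordinal mn) tail_sqr Q (Y i.+1 w) by exact: sumr_ge0.
have Y0 := time_ge0 m; rewrite /tail_sqr; have := sqr_ge0 Q.
have [YQ|QY] := leP (Y m.+1 w) Q; last by lra.
have : Y m.+1 w ^+ 2 <= Q ^+ 2 by apply: lerXn2r.
by lra.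
Qed.

Section drift_sum_bounds.
Variables (theta c T : R) (n : nat).
Hypotheses (theta0 : 0 <= theta) (c0 : 0 <= c) (T0 : 0 <= T) (TD : T < D n w).
Local Notation beta := (theta + c).

Lemma drift_sum_le (delta : R) : 0 < delta ->
  drift_sum theta c (capped_age T) T n w <=
  (1 + delta) * path_cost T n w - beta * T
  + crossing_const theta c delta * (1 + overshoot T n w).
Proof.
move=> delta0; have [m mn crossing] := crossing_exists T0 TD.
rewrite /drift_sum (stopped_sum_crossing mn crossing)/=.
rewrite (sum_drift _ (b := capped_age T))//; last first.
  move=> i im; rewrite /capped_age min_l//; have := deliv_le_crossing crossing i.+1.
  by rewrite im delivS => DT; have := time_ge0 i; lra.
rewrite (path_cost_crossing mn crossing) (overshoot_crossing mn crossing).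
apply: crossing_drift_le => //.
- exact: deliv_age_ge0.
- exact: time_ge0.
- exact: deliv_age_sqr_le_deliv_cost.
- by rewrite /A; ring.
Qed.

Lemma path_cost_threshold_le : waits_until theta w ->
  path_cost T n w <= drift_sum theta c (fun i w => Num.max (A i w) theta) T n w
    + beta * T + beta * (theta + 1 + overshoot T n w).
Proof.
move=> Z_thr; have [m mn crossing] := crossing_exists T0 TD.
have waitE i : Num.max (A i w) theta = A i w + pol_Z pi i w.
  by rewrite Z_thr addr_maxr addrC subrK addr0 maxC.
rewrite /drift_sum (stopped_sum_crossing mn crossing)/=.
rewrite (sum_drift _ (b := fun i w => Num.max (A i w) theta))//.
rewrite (path_cost_crossing mn crossing) (overshoot_crossing mn crossing) waitE.
apply: crossing_cost_le => //.
- exact: deliv_age_ge0.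
- by rewrite Z_ge0 Z_thr ge_max theta0 gerBl deliv_age_ge0.
- exact: time_ge0.
- by rewrite /A; ring.
Qed.

End drift_sum_bounds.

End path.
End dynamics.

Section integral_age.
Context {R : realType}.
Notation mu := (@lebesgue_measure R).

Lemma integral_subr (L p q : R) : p <= q ->
  (\int[mu]_(t in `[p, q]) (t - L)%:E)%E = (((q - L) ^+ 2 - (p - L) ^+ 2) / 2)%:E.
Proof.
rewrite le_eqVlt => /predU1P[->|pq].
  by rewrite set_itv1 integral_set1 subrr mul0r.
pose F (t : R) : R := (t - L) ^+ 2 / 2.
have dF (t : R) : is_derive t 1 F (t - L).
  by apply: is_derive_eq; rewrite /GRing.scale/=; field.
have cF (t : R) : {for t, continuous F}.
  by apply: differentiable_continuous; apply/derivable1_diffP; have [] := dF t.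
rewrite (@continuous_FTC2 _ _ F)//.
- by rewrite -EFinB mulrBl.
- apply: continuous_subspaceT => t.
  by apply: cvgB; [exact: cvg_id|exact: cvg_cst].
- split; first by move=> t _; have [] := dF t.
  + exact/cvg_at_right_filter/cF.
  + exact/cvg_at_left_filter/cF.
- by move=> t _; rewrite derive1E; have [_] := dF t.
Qed.

Definition itvco_integral (f : R -> R) (p q v : R) : Prop :=
  measurable_fun `[p, q[ (EFin \o f) /\ (\int[mu]_(t in `[p, q[) (f t)%:E)%E = v%:E.

Lemma itvco_integral_cat f p q r u v : p <= q <= r ->
  itvco_integral f p q u -> itvco_integral f q r v -> itvco_integral f p r (u + v).
Proof.
move=> /andP[pq qr] [mpq pqE] [mqr qrE]; rewrite /itvco_integral.
have -> : `[p, r[%classic = `[p, q[%classic `|` `[q, r[%classic.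
  by rewrite -itv_bndbnd_setU// bnd_simp.
have mU : measurable_fun (`[p, q[%classic `|` `[q, r[%classic) (EFin \o f).
  by apply/measurable_funU.
split => //; rewrite integral_setU//; first by rewrite pqE qrE.
apply/disj_setPS => t [/=]; rewrite !in_itv/= => /andP[_ tq] /andP[qt _].
by have := lt_le_trans tq qt; rewrite ltxx.
Qed.

Context {d : measure_display} {Omega : measurableType d}.
Variables (Y : nat -> Omega -> R) (succ : nat -> Omega -> bool).
Variables (pi : policy (Omega := Omega) (R := R)) (w : Omega) (eps : R).
Hypotheses (eps0 : 0 < eps) (Y_ge_eps : forall i, eps <= Y i.+1 w)
  (Z_ge0 : forall i, 0 <= pol_Z pi i w).
Local Notation D i := (deliv Y pi i w).
Local Notation L i := (fresh_samp Y succ pi i w).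

Lemma fresh_samp_delivered i : exists k,
  [/\ (k <= i)%N, delivered succ k w & samp Y pi k w = L i].
Proof.
elim: i => [|i [k [ki k_deliv kE]]]; first by exists 0%N.
have [succ_i|fail_i] := boolP (succ i.+1 w).
  by exists i.+1; rewrite /delivered /= succ_i.
by exists k; rewrite /= (negbTE fail_i) leqW.
Qed.

Lemma samp_le_fresh_samp i k : (k <= i)%N -> delivered succ k w -> samp Y pi k w <= L i.
Proof.
move=> + k_deliv; elim: i => [|i IHi]; first by rewrite leqn0 => /eqP ->.
rewrite leq_eqVlt ltnS => /predU1P[kE|/IHi/le_trans]; last first.
  by apply; exact: fresh_samp_leS eps0 Y_ge_eps Z_ge0 i.
by move: k_deliv; rewrite kE /delivered/= => ->.
Qed.

Lemma age_fresh_samp i t : D i <= t < D i.+1 -> age Y succ pi t w = t - L i.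
Proof.
move=> /andP[Dt tD]; rewrite /age; congr (_ - _).
set samps := [set _ | _ in _].
have sampsL : samps (L i).
  have [k [ki k_deliv <-]] := fresh_samp_delivered i; exists k => //; split => //.
  exact: le_trans (deliv_nondecreasing eps0 Y_ge_eps Z_ge0 ki) Dt.
have ub_samps : ubound samps (L i).
  move=> _ [k [k_deliv Dk] <-]; apply: samp_le_fresh_samp => //.
  rewrite leqNgt; apply/negP => /(deliv_nondecreasing eps0 Y_ge_eps Z_ge0) Dik.
  by have := le_lt_trans (le_trans Dik Dk) tD; rewrite ltxx.
apply/eqP; rewrite eq_le; apply/andP; split.
- by apply: ge_sup => //; exists (L i).
- by apply: ub_le_sup => //; exists (L i).
Qed.

Lemma integral_age_slot i p q : D i <= p -> p <= q -> q <= D i.+1 ->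
  itvco_integral (fun t => age Y succ pi t w) p q (((q - L i) ^+ 2 - (p - L i) ^+ 2) / 2).
Proof.
move=> Dp pq qD.
have ageE t : t \in `[p, q[%classic -> t - L i = age Y succ pi t w.
  rewrite inE/= in_itv/= => /andP[pt tq]; rewrite (@age_fresh_samp i)//.
  by rewrite (le_trans Dp pt) (lt_le_trans tq qD).
have m_subr : measurable_fun `[p, q[ (fun t => (t - L i)%:E).
  by apply/measurable_EFinP; exact: measurable_funB.
split; first by apply: eq_measurable_fun m_subr => t /ageE/= ->.
under eq_integral => t /ageE <- do [].
by rewrite integral_itv_bndo_bndc// integral_subr.
Qed.

Lemma integral_age_to_deliv m :
  itvco_integral (fun t => age Y succ pi t w) 0 (D m) (deliv_cost Y succ pi m w).
Proof.
elim: m => [|m IHm].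
  rewrite /itvco_integral /deliv_cost big_ord0 set_itv_ge ?bnd_simp ?ltxx//.
  by split; [exact: measurable_fun_set0|rewrite integral_set0].
rewrite /deliv_cost big_ord_recr/= -/(deliv_cost Y succ pi m w) -delivS.
apply: itvco_integral_cat IHm _.
  by rewrite (deliv_ge0 eps0 Y_ge_eps Z_ge0) (deliv_leS eps0 Y_ge_eps Z_ge0).
by apply: integral_age_slot => //; exact: deliv_leS eps0 Y_ge_eps Z_ge0 m.
Qed.

Lemma integral_age (T : R) n : 0 <= T -> T < D n ->
  (\int[mu]_(t in `[0%R, T]) (age Y succ pi t w)%:E)%E = (path_cost Y succ pi T n w)%:E.
Proof.
move=> T0 TD; have [m mn crossing] := crossing_exists T0 TD.
have /andP[DT TDm] := crossing.
have [mage ageE] : itvco_integral (fun t => age Y succ pi t w) 0 T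
    (path_cost Y succ pi T n w).
  rewrite (path_cost_crossing succ eps0 Y_ge_eps Z_ge0 mn crossing).
  apply: itvco_integral_cat (integral_age_to_deliv m) _.
    by rewrite DT (deliv_ge0 eps0 Y_ge_eps Z_ge0).
  by apply: integral_age_slot => //; exact: ltW.
by rewrite -integral_itv_bndo_bndc.
Qed.

End integral_age.

(** * The average age of a policy *)

Record update_system {d} {Omega : measurableType d} {R : realType}
    (P : probability Omega R) (alpha eps : R)
    (Y : nat -> Omega -> R) (succ : nat -> Omega -> bool) : Prop := UpdateSystem {
  loss_rate_bounds : 0 <= alpha < 1;
  time_bound_gt0 : 0 < eps;
  measurable_time : forall i, measurable_fun setT (Y i);
  measurable_succ : forall i, measurable_fun setT (@succR _ _ R succ i);
  mutually_independent_system : mutually_independent P (sys_family Y succ);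
  law_time : forall i, (1 <= i)%N -> law_eq P P (Y i) (Y 1%N);
  probability_succ : forall i, (1 <= i)%N -> P [set w | succ i w] = (1 - alpha)%:E;
  time_ge_ae : {ae P, forall w, eps <= Y 1%N w};
  time_sqr_lty : ('E_P[fun w => (Y 1%N w ^+ 2)%R] < +oo)%E }.

Section update_system_theory.
Context {d : measure_display} {Omega : measurableType d} {R : realType}.
Variables (P : probability Omega R) (alpha eps : R).
Variables (Y : nat -> Omega -> R) (succ : nat -> Omega -> bool).
Hypothesis sys : update_system P alpha eps Y succ.

Let eps0 : 0 < eps. Proof. exact: time_bound_gt0 sys. Qed.
Let mY : forall i, measurable_fun setT (Y i). Proof. exact: measurable_time sys. Qed.
Let msucc : forall i, measurable_fun setT (@succR _ _ R succ i).
Proof. exact: measurable_succ sys. Qed.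

Lemma success_rate_gt0 : 0 < 1 - alpha.
Proof. by rewrite subr_gt0; case/andP: (loss_rate_bounds sys). Qed.

Lemma law_time1 i : law_eq P P (Y 1%N) (Y i.+1).
Proof. by move=> B mB; rewrite (law_time sys). Qed.

Lemma times_ge_ae : {ae P, forall w, forall i, eps <= Y i.+1 w}.
Proof.
apply: ae_foralln => i.
have := law_eq_ae (mY 1%N) (mY i.+1) (@law_time1 i) (measurable_itv `[eps, +oo[).
move=> ge_ae; have {ge_ae}: {ae P, forall w, `[eps, +oo[%classic (Y i.+1 w)}.
  by apply: ge_ae; apply: filterS (time_ge_ae sys) => w; rewrite /= in_itv/= andbT.
by apply: filterS => w; rewrite /= in_itv/= andbT.
Qed.

Lemma has_mean_time_comp (g : R -> R) a i : measurable_fun setT g ->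
  has_mean P (fun w => g (Y 1%N w)) a -> has_mean P (fun w => g (Y i.+1 w)) a.
Proof. exact: (law_eq_has_mean (X := Y 1%N) (mY 1%N) (mY i.+1) (@law_time1 i)). Qed.

Definition mean_time : R := \int[P]_w Y 1%N w.
Definition mean_time_sqr : R := \int[P]_w (Y 1%N w ^+ 2).
Local Notation m := mean_time.
Local Notation s := mean_time_sqr.
Local Notation c := (m / (1 - alpha)).

Lemma has_mean_time_sqr i : has_mean P (fun w => Y i.+1 w ^+ 2) s.
Proof.
apply: (has_mean_time_comp _ (exprn_measurable 2)); split => //.
apply/integrableP; split; first by apply/measurable_EFinP; exact: measurable_funX.
have := time_sqr_lty sys; rewrite unlock; apply: le_lt_trans.
by apply: ge0_ae_le_integral => [//|w|]; rewrite ?lee_fin ?sqr_ge0//;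
  apply: aeW => w; rewrite /= ger0_norm ?sqr_ge0.
Qed.

Lemma has_mean_time i : has_mean P (Y i.+1) m.
Proof.
apply: (@has_mean_time_comp id) => //.
apply: ae_le_normr_has_mean (has_meanD (has_mean_cst P 1) (has_mean_time_sqr 0)) _ _ => //.
apply: aeW => w; rewrite ler_norml.
have := sqr_ge0 (Y 1%N w - 1); have := sqr_ge0 (Y 1%N w + 1); have := sqr_ge0 (Y 1%N w).
by rewrite !expr2 => ? ? ?; apply/andP; split; lra.
Qed.

Lemma cY_mean_time : cY P Y alpha = c.
Proof. by rewrite /cY (has_mean_expectation (has_mean_time 0)). Qed.

Lemma mean_time_ge0 : 0 <= m.
Proof.
apply: ae_le_has_mean (has_mean_cst P 0) (has_mean_time 0) _.
by apply: filterS times_ge_ae => w /(_ 0%N); apply: le_trans; exact: ltW.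
Qed.

Lemma mean_time_per_success_ge0 : 0 <= c.
Proof. by rewrite divr_ge0 ?mean_time_ge0// ltW// success_rate_gt0. Qed.

Lemma has_mean_succ i : has_mean P (@succR _ _ R succ i.+1) (1 - alpha).
Proof.
have msucc_set : measurable [set w | succ i.+1 w].
  rewrite (_ : [set w | _] = @succR _ _ R succ i.+1 @^-1` [set 1]).
    exact: preimage_measurable.
  apply/seteqP; split => w /=; rewrite /succR; first by move=> ->.
  by case: (succ i.+1 w) => // /eqP; rewrite eq_sym oner_eq0.
have -> : @succR _ _ R succ i.+1 = \1_[set w | succ i.+1 w].
  by apply/funext => w; rewrite /succR indicE mem_setE.
split; first exact: integrable_indic.
rewrite /Rintegral integral_indic// setIT.
exact: (congr1 fine (probability_succ sys (i := i.+1) isT)).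
Qed.

Lemma measurable_sys_family x : measurable_fun setT (sys_family Y succ x).
Proof. by case: x => k; [exact: mY|exact: msucc]. Qed.

Lemma has_mean_succ_mul (g : R -> R) a i : measurable_fun setT g ->
  has_mean P (fun w => g (Y 1%N w)) a ->
  has_mean P (fun w => @succR _ _ R succ i.+1 w * g (Y i.+1 w)) ((1 - alpha) * a).
Proof.
move=> mg ga; have disj : [set inr i] `&` [set inl i] = set0 :> set (nat + nat).
  by apply/seteqP; split => // x /= [->].
have ind := mutually_independent_blocks measurable_sys_family
  (mutually_independent_system sys) disj.
apply: has_mean_mul_indep ind _ _ (has_mean_succ i) (has_mean_time_comp _ mg ga).
- by apply/sigma_measurableP; apply: sigma_measurable_gen; exists (inr i).
- apply/sigma_measurableP; apply: measurableT_comp => //.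
  by apply: sigma_measurable_gen; exists (inl i).
Qed.

Section policy.
Variable pi : policy (Omega := Omega) (R := R).
Hypothesis piP : in_Pi P Y succ pi.
Local Notation D := (deliv Y pi).
Local Notation A := (deliv_age Y succ pi).

Definition history i : set (Omega -> R) :=
  [set X | X = pol_U pi \/ exists2 k, (1 <= k <= i)%N & (X = Y k \/ X = succR succ k)].

Definition step i : set (Omega -> R) := [set X | X = Y i.+1 \/ X = succR succ i.+1].

Lemma wait_ge0 i w : 0 <= pol_Z pi i w. Proof. by case: piP. Qed.

Lemma sigma_measurable_wait i : sigma_measurable (history i) (pol_Z pi i).
Proof. by apply/sigma_measurableP; case: piP => _ _ _ /(_ i). Qed.

Lemma history_measurable i (f : Omega -> R) :
  sigma_measurable (history i) f -> measurable_fun setT f.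
Proof.
by apply: sigma_measurable_fun => X [->|[k _ [->|->]]//]; case: piP.
Qed.

Lemma indep_history_step i :
  indep_sigma P (sigma_gen (history i)) (sigma_gen (step i)).
Proof.
have [mU indU _ _ _] := piP.
pose X (o : option (nat + nat)) := if o is Some x then sys_family Y succ x else pol_U pi.
have mX o : measurable_fun setT (X o) by case: o => // x; exact: measurable_sys_family.
have indX : mutually_independent P X.
  exact: (mutually_independent_adjoin measurable_sys_family
    (mutually_independent_system sys) mU indU).
pose past : set (option (nat + nat)) := [set o | o = None \/
  exists2 k, (k < i)%N & (o = Some (inl k) \/ o = Some (inr k))].
pose next : set (option (nat + nat)) := [set o | o = Some (inl i) \/ o = Some (inr i)].
have disj : past `&` next = set0.
  apply/seteqP; split => // o [] /= [->|[k ki [->|->]]] [] //= [] kE;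
    by rewrite kE ltnn in ki.
apply: indep_sigmaS (mutually_independent_blocks mX indX disj); apply: sigma_genS => Z.
- move=> [->|[[//|k] ki [->|->]]].
  + by exists None => //; left.
  + by exists (Some (inl k)) => //; right; exists k => //; left.
  + by exists (Some (inr k)) => //; right; exists k => //; right.
- move=> [->|->].
  + by exists (Some (inl i)) => //; left.
  + by exists (Some (inr i)) => //; right.
Qed.

Lemma has_mean_history_step i (f g : Omega -> R) a b :
  sigma_measurable (history i) f -> sigma_measurable (step i) g ->
  has_mean P f a -> has_mean P g b -> has_mean P (fun w => f w * g w) (a * b).
Proof.
by move=> mf mg; apply: has_mean_mul_indep (@indep_history_step i) _ _;
  exact/sigma_measurableP.
Qed.

End policy.
End update_system_theory.

Section adapted.
Context {d : measure_display} {Omega : measurableType d} {R : realType}.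
Variables (Y : nat -> Omega -> R) (succ : nat -> Omega -> bool).
Variable pi : policy (Omega := Omega) (R := R).
Local Notation H := (history Y succ pi).

Lemma sigma_measurable_historyS i (f : Omega -> R) :
  sigma_measurable (H i) f -> sigma_measurable (H i.+1) f.
Proof.
apply: sigma_measurableS => X [->|[k /andP[k1 ki] XE]]; first by left.
by right; exists k => //; rewrite k1 leqW.
Qed.

Lemma sigma_measurable_time i : sigma_measurable (H i.+1) (Y i.+1).
Proof.
by apply: sigma_measurable_gen; right; exists i.+1 => //; [rewrite leqnn|left].
Qed.

Lemma sigma_measurable_succ i : sigma_measurable (H i.+1) (@succR _ _ R succ i.+1).
Proof.
by apply: sigma_measurable_gen; right; exists i.+1 => //; [rewrite leqnn|right].
Qed.

Hypothesis wait_adapted : forall i, sigma_measurable (H i) (pol_Z pi i).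

Lemma sigma_measurable_deliv i : sigma_measurable (H i) (deliv Y pi i).
Proof.
elim: i => [|i IHi]; first exact: measurable_cst.
apply: measurable_funD; last exact: sigma_measurable_time.
by apply: measurable_funD; exact: sigma_measurable_historyS.
Qed.

Lemma sigma_measurable_fresh_samp i : sigma_measurable (H i) (fresh_samp Y succ pi i).
Proof.
elim: i => [|i IHi]; first exact: measurable_cst.
rewrite (_ : fresh_samp _ _ _ _ = fun w => succR succ i.+1 w * samp Y pi i.+1 w
    + (1 - succR succ i.+1 w) * fresh_samp Y succ pi i w); last first.
  by apply/funext => w /=; rewrite /succR; case: (succ i.+1 w) => /=; ring.
have msucc := @sigma_measurable_succ i.
apply: measurable_funD; apply: measurable_funM => //.
- apply: measurable_funD; apply: sigma_measurable_historyS => //.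
  exact: sigma_measurable_deliv.
- exact: measurable_funB.
- exact: sigma_measurable_historyS.
Qed.

Lemma sigma_measurable_deliv_age i : sigma_measurable (H i) (deliv_age Y succ pi i).
Proof.
apply: measurable_funB; first exact: sigma_measurable_deliv.
exact: sigma_measurable_fresh_samp.
Qed.

Lemma sigma_measurable_reached T i : sigma_measurable (H i) (reached Y pi T i).
Proof.
apply: measurable_fun_natrb; apply: measurable_fun_ler => //.
exact: sigma_measurable_deliv.
Qed.

End adapted.

(* With [c = m / (1 - alpha)], this is the root equation for [beta = theta + c] once the
   moments of the geometric sum [Y'] are evaluated. *)
Definition threshold_equation {d} {Omega : measurableType d} {R : realType}
    (P : probability Omega R) (X : Omega -> R) (alpha m s theta : R) : Prop :=
  has_mean P (fun w => sqr_excess theta (X w))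
    (theta ^+ 2 + 2 * alpha * (m / (1 - alpha)) * theta - alpha * s / (1 - alpha)).

Section average_age.
Context {d : measure_display} {Omega : measurableType d} {R : realType}.
Variables (P : probability Omega R) (alpha eps theta : R).
Variables (Y : nat -> Omega -> R) (succ : nat -> Omega -> bool).
Hypothesis sys : update_system P alpha eps Y succ.
Local Notation m := (mean_time P Y).
Local Notation s := (mean_time_sqr P Y).
Local Notation c := (m / (1 - alpha)).
Local Notation beta := (theta + c).
Hypotheses (theta0 : 0 <= theta) (thetaE : threshold_equation P (Y 1%N) alpha m s theta).

Let eps0 : 0 < eps. Proof. exact: time_bound_gt0 sys. Qed.
Let mY : forall i, measurable_fun setT (Y i). Proof. exact: measurable_time sys. Qed.
Let c0 : 0 <= c. Proof. exact: mean_time_per_success_ge0 sys. Qed.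

Lemma has_mean_relval : has_mean P (fun w => relval theta c (Y 1%N w))
  ((theta ^+ 2 + 2 * alpha * c * theta - alpha * s / (1 - alpha)) / 2 - s / 2 + beta * m).
Proof.
have := has_meanD (has_meanB (has_meanZ 2^-1 thetaE) (has_meanZ 2^-1 (has_mean_time_sqr sys 0)))
  (has_meanZ beta (has_mean_time sys 0)).
by rewrite ![2^-1 * _]mulrC; apply: eq_has_mean => w; rewrite /relval ![2^-1 * _]mulrC.
Qed.

Let msucc i : sigma_measurable (step Y succ i) (@succR _ _ R succ i.+1).
Proof. by apply: sigma_measurable_gen; right. Qed.

Let mtime i : sigma_measurable (step Y succ i) (Y i.+1).
Proof. by apply: sigma_measurable_gen; left. Qed.

Lemma sigma_measurable_drift_slope i : sigma_measurable (step Y succ i)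
  (fun w => drift_slope theta c (succ i.+1 w) (Y i.+1 w)).
Proof. by apply: measurable_funB => //; exact: measurable_funM. Qed.

Lemma sigma_measurable_drift_intercept i : sigma_measurable (step Y succ i)
  (fun w => drift_intercept theta c (succ i.+1 w) (Y i.+1 w)).
Proof.
apply: measurable_funD.
  apply: measurable_funB; last exact: measurable_funM.
  by apply: measurable_funM => //; exact: measurable_funX.
apply: measurable_funM => //; apply: measurable_funB; last exact: measurable_funM.
by apply: measurableT_comp => //; exact: measurable_relval.
Qed.

Lemma has_mean_drift_slope i :
  has_mean P (fun w => drift_slope theta c (succ i.+1 w) (Y i.+1 w)) (- theta * (1 - alpha)).
Proof.
rewrite (_ : - theta * _ = m - beta * (1 - alpha)); last first.
  by field; rewrite gt_eqF// (success_rate_gt0 sys).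
apply: has_meanB; first exact: has_mean_time sys i.
exact: has_meanZ (has_mean_succ sys i).
Qed.

Lemma has_mean_drift_intercept i :
  has_mean P (fun w => drift_intercept theta c (succ i.+1 w) (Y i.+1 w))
    ((1 - alpha) * theta ^+ 2 / 2).
Proof.
have mrel : measurable_fun setT (fun y : R => relval theta c y - c * y).
  by apply: measurable_funB; [exact: measurable_relval|exact: measurable_funM].
have := has_meanD
  (has_meanB (has_meanZ 2^-1 (has_mean_time_sqr sys i)) (has_meanZ theta (has_mean_time sys i)))
  (has_mean_succ_mul sys i mrel
    (has_meanB has_mean_relval (has_meanZ c (has_mean_time sys 0)))).
set v := (X in has_mean _ _ X) => mean_v.
rewrite (_ : _ / 2 = v).
  by apply: eq_has_mean mean_v => w; rewrite /drift_intercept [2^-1 * _]mulrC.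
by rewrite /v; field; rewrite gt_eqF// (success_rate_gt0 sys).
Qed.

Definition slots (T : R) : nat := (Num.truncn (T / eps)).+1.

Lemma slots_gt T : T < (slots T)%:R * eps.
Proof. by rewrite -ltr_pdivrMr// truncnS_gt. Qed.

Lemma slots_le T : 0 <= T -> (slots T)%:R <= T / eps + 1.
Proof. by move=> T0; rewrite -natr1 lerD2r truncn_le// divr_ge0// ltW. Qed.

Definition mean_tail_sqr Q : R := \int[P]_w tail_sqr Q (Y 1%N w).

Lemma tail_sqr_bounds (Q x : R) : 0 <= tail_sqr Q x <= x ^+ 2.
Proof. by rewrite /tail_sqr; case: ifP; rewrite ?lexx ?sqr_ge0. Qed.

Lemma measurable_tail_sqr Q : measurable_fun setT (@tail_sqr R Q).
Proof. by apply: measurable_fun_ifT => //; exact: measurable_fun_ltr. Qed.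

Lemma has_mean_tail_sqr Q i : has_mean P (fun w => tail_sqr Q (Y i.+1 w)) (mean_tail_sqr Q).
Proof.
apply: (has_mean_time_comp sys _ (measurable_tail_sqr Q)).
apply: ae_le_normr_has_mean (has_mean_time_sqr sys 0) _ _.
  by apply: measurableT_comp; [exact: measurable_tail_sqr|exact: mY].
by apply: aeW => w; have /andP[tail0 ?] := tail_sqr_bounds Q (Y 1%N w); rewrite ger0_norm.
Qed.

Lemma mean_tail_sqr_ge0 Q : 0 <= mean_tail_sqr Q.
Proof. by apply: Rintegral_ge0 => w _; case/andP: (tail_sqr_bounds Q (Y 1%N w)). Qed.

Lemma cvg_mean_tail_sqr : mean_tail_sqr n%:R @[n --> \oo] --> 0.
Proof.
suff : (\int[P]_w (tail_sqr n%:R (Y 1%N w))%:E @[n --> \oo] --> \int[P]_w (cst 0 w))%E.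
  by rewrite integral0 => /fine_cvg.
have mtail n : measurable_fun setT (fun w => (tail_sqr n%:R (Y 1%N w))%:E).
  by apply/measurable_EFinP/measurableT_comp; [exact: measurable_tail_sqr|exact: mY].
have [] // := @dominated_convergence _ _ _ P setT measurableT
  (fun n w => (tail_sqr n%:R (Y 1%N w))%:E) (cst 0%E) (fun w => (Y 1%N w ^+ 2)%:E).
- apply: aeW => w _; apply: cvg_near_cst; near=> n.
  apply/eqP; rewrite /tail_sqr ltNge (_ : Y 1%N w <= n%:R)//.
  by near: n; exact: nbhs_infty_ger.
- by case: (has_mean_time_sqr sys 0).
- apply: aeW => w n _ /=; have /andP[tail0 tailY] := tail_sqr_bounds n%:R (Y 1%N w).
  by rewrite lee_fin ger0_norm.
Unshelve. all: by end_near. Qed.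

Section policy.
Variable pi : policy (Omega := Omega) (R := R).
Hypothesis piP : in_Pi P Y succ pi.
Local Notation D := (deliv Y pi).
Local Notation A := (deliv_age Y succ pi).
Local Notation H := (history Y succ pi).

Let Z_ge0 w i : 0 <= pol_Z pi i w. Proof. exact: wait_ge0 piP i w. Qed.
Let mZ i : sigma_measurable (H i) (pol_Z pi i). Proof. exact: sigma_measurable_wait piP i. Qed.
Let mD i : sigma_measurable (H i) (D i). Proof. exact: sigma_measurable_deliv. Qed.
Let mA i : sigma_measurable (H i) (A i). Proof. exact: sigma_measurable_deliv_age. Qed.
Let mreached T i : sigma_measurable (H i) (reached Y pi T i).
Proof. exact: sigma_measurable_reached. Qed.

Lemma has_mean_stopped T i (f : Omega -> R) (M : R) : measurable_fun setT f ->
  {ae P, forall w, D i w <= T -> `|f w| <= M} ->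
  has_mean P (fun w => reached Y pi T i w * f w) (\int[P]_w (reached Y pi T i w * f w)).
Proof.
move=> mf fM; apply: ae_le_normr_has_mean (has_mean_cst P `|M|) _ _.
  by apply: measurable_funM => //; exact: (history_measurable sys piP (@mreached T i)).
apply: filterS fM => w fM; rewrite normrM /reached; case: (boolP (D i w <= T)) => DT.
  by rewrite normr1 mul1r (le_trans (fM DT))// ler_norm.
by rewrite normr0 mul0r.
Qed.

Lemma has_mean_stopped_step T i (f g : Omega -> R) (M v : R) :
  sigma_measurable (H i) f -> {ae P, forall w, D i w <= T -> `|f w| <= M} ->
  sigma_measurable (step Y succ i) g -> has_mean P g v ->
  has_mean P (fun w => reached Y pi T i w * f w * g w)
    ((\int[P]_w (reached Y pi T i w * f w)) * v).
Proof.
move=> mf fM mg gv; apply: (has_mean_history_step sys piP _ mg) gv.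
  exact: (measurable_funM (@mreached T i) mf).
by apply: has_mean_stopped fM; exact: (history_measurable sys piP mf).
Qed.

Section drift_bound_mean.
Variables (T M : R) (i : nat) (b : Omega -> R).
Hypothesis mb : sigma_measurable (H i) b.
Hypothesis b_bounds : {ae P, forall w, D i w <= T -> 0 <= b w <= M}.
Let one (_ : Omega) : R := 1.
Let quad w : R := b w ^+ 2 - sqr_excess theta (b w).

Let mone : sigma_measurable (H i) one. Proof. exact: measurable_cst. Qed.

Let mquad : sigma_measurable (H i) quad.
Proof.
apply: measurable_funB; first exact: measurable_funX.
by apply: measurableT_comp => //; exact: measurable_sqr_excess.
Qed.

Let one_le : {ae P, forall w, D i w <= T -> `|one w| <= 1}.
Proof. by apply: aeW => w _; rewrite normr1. Qed.

Let b_le : {ae P, forall w, D i w <= T -> `|b w| <= M}.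
Proof. by apply: filterS b_bounds => w bM /bM/andP[b_ge0 ?]; rewrite ger0_norm. Qed.

Let quad_le : {ae P, forall w, D i w <= T -> `|quad w| <= M ^+ 2}.
Proof. by apply: filterS b_bounds => w bM /bM; exact: sqr_sub_excess_le. Qed.

Lemma has_mean_stopped_shortfall :
  has_mean P (fun w => reached Y pi T i w * sqr_excess (b w) theta)
  (\int[P]_w (reached Y pi T i w * quad w) - 2 * theta * \int[P]_w (reached Y pi T i w * b w)
   + theta ^+ 2 * \int[P]_w (reached Y pi T i w * one w)).
Proof.
have stopped f C mf := @has_mean_stopped T i f C (history_measurable sys piP mf).
have := has_meanD (has_meanB (stopped _ _ _ mquad quad_le)
  (has_meanZ (2 * theta) (stopped _ _ _ mb b_le)))
  (has_meanZ (theta ^+ 2) (stopped _ _ _ mone one_le)).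
apply: eq_has_mean => w; rewrite /quad /one /sqr_excess.
by have [?|?] := leP (b w - theta) 0; [rewrite max_l|rewrite max_r]; try lra; ring.
Qed.

Lemma has_mean_drift_bound :
  has_mean P (fun w => reached Y pi T i w * drift_bound theta c (succ i.+1 w) (b w) (Y i.+1 w))
    ((1 - alpha) / 2 * \int[P]_w (reached Y pi T i w * sqr_excess (b w) theta)).
Proof.
have mhalf_succ : sigma_measurable (step Y succ i) (fun w => 2^-1 * succR succ i.+1 w : R).
  exact: measurable_funM.
have := has_meanD (has_meanD
  (has_mean_stopped_step mquad quad_le mhalf_succ (has_meanZ 2^-1 (has_mean_succ sys i)))
  (has_mean_stopped_step mb b_le (@sigma_measurable_drift_slope i)
    (has_mean_drift_slope i)))
  (has_mean_stopped_step mone one_le (@sigma_measurable_drift_intercept i)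
    (has_mean_drift_intercept i)).
set v := (X in has_mean _ _ X) => v_mean.
case: has_mean_stopped_shortfall => _ ->.
rewrite [X in has_mean _ _ X](_ : _ = v); last by rewrite /v; field.
by apply: eq_has_mean v_mean => w; rewrite /quad /one /drift_bound /succR; ring.
Qed.

End drift_bound_mean.

Definition mean_path_cost T n : R := \int[P]_w path_cost Y succ pi T n w.
Definition mean_overshoot T n : R := \int[P]_w overshoot Y pi T n w.

Lemma has_mean_path_cost T n : has_mean P (path_cost Y succ pi T n) (mean_path_cost T n).
Proof.
have mslot i : measurable_fun setT (slot_cost Y succ pi T i).
  apply: (history_measurable sys piP (i := i.+1)).
  have mAi := sigma_measurable_historyS (@mA i).
  have mLi := sigma_measurable_historyS (sigma_measurable_fresh_samp mZ (i := i)).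
  apply: measurable_funM => //; apply: measurable_funB; last exact: measurable_funX.
  by apply: measurable_funX; apply: measurable_funB => //; exact: measurable_minr.
have slot_le i : {ae P, forall w, D i w <= T -> `|slot_cost Y succ pi T i w| <= T ^+ 2}.
  apply: filterS (times_ge_ae sys) => w Yw.
  exact: (slot_cost_bounded succ eps0 Yw (Z_ge0 w)).
have [cost_int _] := has_mean_sum n (fun i => has_mean_stopped (mslot i) (slot_le i)).
by split.
Qed.

Lemma has_mean_overshoot T n : has_mean P (overshoot Y pi T n) (mean_overshoot T n).
Proof.
pose term i w : R := reached Y pi T i w * ((T < D i.+1 w)%R%:R * Y i.+1 w ^+ 2).
have mterm i : measurable_fun setT (term i).
  apply: (history_measurable sys piP (i := i.+1)).
  apply: measurable_funM; first exact: sigma_measurable_historyS.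
  apply: measurable_funM; first by apply: measurable_fun_natrb; exact: measurable_fun_ltr.
  by apply: measurable_funX; exact: sigma_measurable_time.
have term_le i : {ae P, forall w, `|term i w| <= Y i.+1 w ^+ 2}.
  apply: aeW => w; rewrite /term; have := sqr_ge0 (Y i.+1 w).
  rewrite /reached; case: (_ <= T); case: (T < _);
    by rewrite /= ?mul0r ?mul1r ?normr0// => /ger0_norm ->.
have [over_int _] := has_mean_sum n (fun i =>
  ae_le_normr_has_mean (has_mean_time_sqr sys i) (mterm i) (term_le i)).
by split.
Qed.

Lemma deliv_slots_gt T w : (forall i, eps <= Y i.+1 w) -> T < D (slots T) w.
Proof. by move=> Yw; apply: lt_le_trans (slots_gt T) (deliv_ge_muln Yw (Z_ge0 w) _). Qed.

Local Notation cost T := (mean_path_cost T (slots T)).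
Local Notation over T := (mean_overshoot T (slots T)).

Lemma avg_age_path_cost T : 0 <= T -> avg_age P Y succ pi T = (T^-1 * cost T)%:E.
Proof.
move=> T0; rewrite /avg_age EFinM; congr (_ * _)%E.
rewrite -(has_mean_integral (has_mean_path_cost T (slots T))).
apply: eq_ae_integral; apply: filterS (times_ge_ae sys) => w Yw.
exact: (integral_age succ eps0 Yw (Z_ge0 w) T0 (deliv_slots_gt T Yw)).
Qed.

Lemma mean_overshoot_le T Q : 0 <= T -> 0 <= Q ->
  over T <= Q ^+ 2 + (slots T)%:R * mean_tail_sqr Q.
Proof.
move=> T0 Q0; have := has_meanD (has_mean_cst P (Q ^+ 2))
  (has_mean_sum (slots T) (has_mean_tail_sqr Q)).
rewrite sumr_const card_ord mulr_natl => bound_mean.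
apply: ae_le_has_mean (has_mean_overshoot T (slots T)) bound_mean _.
apply: filterS (times_ge_ae sys) => w Yw.
exact: (overshoot_le eps0 Yw (Z_ge0 w) T0 (deliv_slots_gt T Yw) Q0).
Qed.

Lemma mean_overshoot_sublinear eta : 0 < eta -> \forall T \near +oo, over T <= eta * T.
Proof.
move=> eta0; have eps_gt0 := eps0.
have [Q Q0 tailQ] : exists2 Q, 0 <= Q & mean_tail_sqr Q <= eta * eps / 2.
  have eta_eps : 0 < eta * eps / 2 by rewrite !mulr_gt0 ?invr_gt0.
  have [N _ tailN] := cvgr_le _ cvg_mean_tail_sqr _ eta_eps.
  by exists N%:R => //; exact: tailN (leqnn N).
near=> T; have T_large : 2 * (Q ^+ 2 + mean_tail_sqr Q) / eta <= T.
  by near: T; apply: nbhs_pinfty_ge; exact: num_real.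
have T0 : 0 <= T.
  apply: le_trans T_large; rewrite divr_ge0 ?(ltW eta0)// mulr_ge0//.
  by rewrite addr_ge0 ?sqr_ge0 ?mean_tail_sqr_ge0.
apply: le_trans (mean_overshoot_le T0 Q0) _.
have : (slots T)%:R * mean_tail_sqr Q <= (T / eps + 1) * mean_tail_sqr Q.
  by rewrite ler_wpM2r ?slots_le ?mean_tail_sqr_ge0.
have : T / eps * mean_tail_sqr Q <= T / eps * (eta * eps / 2).
  by rewrite ler_wpM2l ?divr_ge0// ltW.
rewrite (_ : T / eps * (_ / 2) = eta * T / 2); last by field; rewrite gt_eqF.
by move: T_large; rewrite ler_pdivrMr//; lra.
Unshelve. all: by end_near. Qed.

Lemma mean_path_cost_ge delta T : 0 < delta -> 0 <= T ->
  beta * T <= (1 + delta) * cost T + crossing_const theta c delta * (1 + over T).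
Proof.
move=> delta0 T0.
have mcapped i : sigma_measurable (H i) (capped_age Y succ pi T i).
  by apply: measurable_funD => //; apply: measurable_minr => //; exact: measurable_funB.
have capped_bounds i : {ae P, forall w, D i w <= T -> 0 <= capped_age Y succ pi T i w <= T}.
  apply: filterS (times_ge_ae sys) => w Yw.
  exact: (capped_age_bounds succ eps0 Yw (Z_ge0 w)).
have := has_mean_sum (slots T) (fun i =>
  has_mean_drift_bound (mcapped i) (capped_bounds i)).
set shortfall := (X in has_mean _ _ X) => bound_mean.
have shortfall_ge0 : 0 <= shortfall.
  apply: sumr_ge0 => i _; rewrite mulr_ge0 ?divr_ge0 ?(ltW (success_rate_gt0 sys))//.
  by apply: Rintegral_ge0 => w _; rewrite mulr_ge0 ?sqr_ge0.
have path_mean := has_meanD (has_meanB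
  (has_meanZ (1 + delta) (has_mean_path_cost T (slots T))) (has_mean_cst P (beta * T)))
  (has_meanZ (crossing_const theta c delta)
    (has_meanD (has_mean_cst P 1) (has_mean_overshoot T (slots T)))).
suff : shortfall <=
    (1 + delta) * cost T - beta * T + crossing_const theta c delta * (1 + over T) by lra.
apply: ae_le_has_mean bound_mean path_mean _; apply: filterS (times_ge_ae sys) => w Yw.
apply: le_trans (drift_sum_le succ eps0 Yw (Z_ge0 w) theta0 c0 T0 (deliv_slots_gt T Yw) delta0).
apply: ler_sum => i _; rewrite /reached.
have [DT|_] := boolP (D i w <= T); last by rewrite !mul0r.
rewrite !mul1r drift_bound_le//; first exact: (time_ge0 eps0 Yw).
by rewrite lerDl le_min Z_ge0/= subr_ge0.
Qed.

Lemma mean_path_cost_le T : 0 <= T ->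
  {ae P, forall w, waits_until Y succ pi theta w} ->
  cost T <= beta * T + beta * (theta + 1 + over T).
Proof.
move=> T0 Z_thr; pose b i w := Num.max (A i w) theta.
have mb i : sigma_measurable (H i) (b i) by exact: measurable_maxr.
have b_bounds i : {ae P, forall w, D i w <= T -> 0 <= b i w <= T + theta}.
  apply: filterS (times_ge_ae sys) => w Yw DT; have theta_ge0 := theta0.
  have := deliv_age_ge0 succ eps0 Yw (Z_ge0 w) i.
  have := deliv_age_le_deliv succ eps0 Yw (Z_ge0 w) i.
  by rewrite /b; have [?|?] := leP (A i w) theta; lra.
have := has_mean_sum (slots T) (fun i =>
  has_mean_drift_bound (mb i) (b_bounds i)).
rewrite [X in has_mean _ _ X]big1 => [bound_mean|i _]; last first.
  rewrite (@eq_Rintegral _ _ _ _ _ (fun=> 0)) => [|w _]; last first.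
    by rewrite /sqr_excess max_r ?expr0n ?mulr0// subr_le0 le_max lexx orbT.
  by case: (has_mean_cst P 0) => _ ->; rewrite mulr0.
rewrite -[X in _ <= X + _]add0r.
apply: ae_le_has_mean (has_mean_path_cost T (slots T))
  (has_meanD (has_meanD bound_mean (has_mean_cst P (beta * T)))
    (has_meanZ beta (has_meanD (has_mean_cst P (theta + 1))
      (has_mean_overshoot T (slots T))))) _.
apply: filterS2 (times_ge_ae sys) Z_thr => w Yw Zw.
apply: le_trans (path_cost_threshold_le eps0 Yw (Z_ge0 w) theta0 c0 T0 (deliv_slots_gt T Yw) Zw) _.
rewrite !lerD2r; apply: ler_sum => i _; rewrite ler_wpM2l// drift_bound_threshold//.
exact: (time_ge0 eps0 Yw).
Qed.

Lemma avg_age_ge_near eta : 0 < eta ->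
  \forall T \near +oo, ((beta - eta)%:E <= avg_age P Y succ pi T)%E.
Proof.
move=> eta0; have theta_ge0 := theta0; have c_ge0 := c0.
pose delta := eta / (4 * (beta + 1)); pose C := crossing_const theta c delta.
have delta0 : 0 < delta by rewrite divr_gt0//; lra.
have C0 : 0 <= C by exact: crossing_const_ge0.
have rate0 : 0 < eta / (4 * (C + 1)) by rewrite divr_gt0//; lra.
near=> T; have over_le : over T <= eta / (4 * (C + 1)) * T.
  by near: T; exact: mean_overshoot_sublinear.
have T_large : 4 * C / eta <= T by near: T; apply: nbhs_pinfty_ge; exact: num_real.
have T0 : 0 < T by near: T; apply: nbhs_pinfty_gt; exact: num_real.
rewrite (avg_age_path_cost (ltW T0)) lee_fin [T^-1 * _]mulrC ler_pdivlMr// leNgt.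
apply/negP => cost_lt.
have := mean_path_cost_ge delta0 (ltW T0); rewrite -/C.
have cost_le : (1 + delta) * cost T <= (1 + delta) * ((beta - eta) * T).
  by rewrite ler_wpM2l ?ltW// addr_gt0.
have C_over : C * over T <= eta / 4 * T.
  have := ler_wpM2l C0 over_le; move/le_trans; apply.
  rewrite mulrA; apply: ler_wpM2r; first exact: ltW.
  by rewrite mulrA ler_pdivrMr; lra.
have C_le : C <= eta / 4 * T by move: T_large; rewrite ler_pdivrMr//; lra.
have delta_beta : delta * beta * T <= eta / 4 * T.
  apply: ler_wpM2r; first exact: ltW.
  by rewrite /delta mulrAC ler_pdivrMr; lra.
have eta_T : 0 < eta * T by exact: mulr_gt0.
have delta_eta_T : 0 <= delta * (eta * T) by rewrite mulr_ge0 ?ltW.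
move: cost_le; rewrite (_ : (1 + delta) * ((beta - eta) * T) =
  beta * T - eta * T + delta * beta * T - delta * (eta * T)); last by ring.
by lra.
Unshelve. all: by end_near. Qed.

Lemma avg_age_le_near eta :
  {ae P, forall w, waits_until Y succ pi theta w} -> 0 < eta ->
  \forall T \near +oo, (avg_age P Y succ pi T <= (beta + eta)%:E)%E.
Proof.
move=> Z_thr eta0; have theta_ge0 := theta0; have c_ge0 := c0.
have beta0 : 0 <= beta by lra.
have rate0 : 0 < eta / (2 * (beta + 1)) by rewrite divr_gt0//; lra.
near=> T; have over_le : over T <= eta / (2 * (beta + 1)) * T.
  by near: T; exact: mean_overshoot_sublinear.
have T_large : 2 * (beta * (theta + 1)) / eta <= T.
  by near: T; apply: nbhs_pinfty_ge; exact: num_real.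
have T0 : 0 < T by near: T; apply: nbhs_pinfty_gt; exact: num_real.
rewrite (avg_age_path_cost (ltW T0)) lee_fin [T^-1 * _]mulrC ler_pdivrMr//.
have beta_over : beta * over T <= eta / 2 * T.
  have := ler_wpM2l beta0 over_le; move/le_trans; apply.
  rewrite mulrA; apply: ler_wpM2r; first exact: ltW.
  by rewrite mulrA ler_pdivrMr; lra.
have := mean_path_cost_le (ltW T0) Z_thr; rewrite mulrDr.
by move: T_large; rewrite ler_pdivrMr//; lra.
Unshelve. all: by end_near. Qed.

Lemma avg_cost_ge : (beta%:E <= avg_cost P Y succ pi)%E.
Proof.
apply/lee_addgt0Pr => eta eta0; rewrite -leeBlDr// -EFinB.
exact: limf_esup_ge_near (avg_age_ge_near eta0).
Qed.

Lemma avg_cost_le :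
  {ae P, forall w, waits_until Y succ pi theta w} ->
  (avg_cost P Y succ pi <= beta%:E)%E.
Proof.
move=> Z_thr; apply/lee_addgt0Pr => eta eta0; rewrite -EFinD.
exact: limf_esup_le_near (avg_age_le_near Z_thr eta0).
Qed.

End policy.
End average_age.

(** * The threshold policy *)

Section threshold_rule.
Context {d : measure_display} {Omega : measurableType d} {R : realType}.
Variables (Y : nat -> Omega -> R) (succ : nat -> Omega -> bool).
Variables (pi : policy (Omega := Omega) (R := R)) (w : Omega) (eps theta : R).
Hypotheses (eps0 : 0 < eps) (Y_ge_eps : forall i, eps <= Y i.+1 w)
  (Z_ge0 : forall i, 0 <= pol_Z pi i w).
Local Notation D i := (deliv Y pi i w).
Local Notation L i := (fresh_samp Y succ pi i w).
Local Notation waits i := [set t | D i <= t /\ theta <= age Y succ pi t w].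

Let ageE i t : D i <= t < D i.+1 -> age Y succ pi t w = t - L i.
Proof. exact: (age_fresh_samp succ eps0 Y_ge_eps Z_ge0). Qed.

Lemma inf_waits i : (exists2 t, waits i t & t < D i.+1) ->
  inf (waits i) = Num.max (D i) (L i + theta).
Proof.
move=> [t [Dt t_old] tD]; set tau := Num.max _ _.
have tau_le u : D i <= u < D i.+1 -> theta <= age Y succ pi u w -> tau <= u.
  by move=> uD; rewrite (ageE uD) lerBrDl ge_max => ->; case/andP: uD => ->.
have tau_t : tau <= t by apply: tau_le; rewrite ?Dt.
have D_tau : D i <= tau by rewrite le_max lexx.
have waits_tau : waits i tau.
  split=> //; rewrite (ageE (i := i)) ?D_tau ?(le_lt_trans tau_t)//.
  by rewrite lerBrDl le_max lexx orbT.
have lb_tau : lbound (waits i) tau.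
  move=> u [Du u_old]; have [uD|Du'] := ltP u (D i.+1).
    by apply: tau_le => //; rewrite Du.
  exact: le_trans tau_t (le_trans (ltW tD) Du').
apply/eqP; rewrite eq_le; apply/andP; split.
- by apply: ge_inf => //; exists tau.
- by apply: lb_le_inf => //; exists tau.
Qed.

Lemma deliv_add_wait i :
  D i + Num.max (theta - deliv_age Y succ pi i w) 0 = Num.max (D i) (L i + theta).
Proof. by rewrite addr_maxr addr0 maxC /deliv_age; congr Num.max; ring. Qed.

Lemma wait_of_threshold : (forall i, samp Y pi i.+1 w = inf (waits i)) ->
  waits_until Y succ pi theta w.
Proof.
move=> sampE i; have eps_gt0 := eps0.
have waits_inf : has_inf (waits i).
  split; last by exists (D i) => t [].
  apply: contrapT => waits0; have : waits i.+1 !=set0.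
    apply: contrapT => waitsS0; have := sampE i.+1; rewrite inf_out => [samp0|[//]].
    have := deliv_ge_muln Y_ge_eps Z_ge0 i.+1; rewrite -natr1 mulrDl mul1r.
    have := mulr_ge0 (ler0n R i) (ltW eps0); have := Z_ge0 i.+1.
    by move: samp0; rewrite /samp; lra.
  move=> [t [Dt t_old]]; apply: waits0; exists t; split => //.
  exact: le_trans (deliv_leS eps0 Y_ge_eps Z_ge0 i) Dt.
have [t waits_t t_lt] := inf_adherent (lt_le_trans eps0 (Y_ge_eps i)) waits_inf.
have infE : inf (waits i) = Num.max (D i) (L i + theta).
  by apply: inf_waits; exists t => //; rewrite delivS; move: t_lt; rewrite -sampE.
by apply: (addrI (D i)); rewrite deliv_add_wait -infE -sampE.
Qed.

Lemma threshold_of_wait : waits_until Y succ pi theta w ->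
  forall i, samp Y pi i.+1 w = inf (waits i).
Proof.
move=> ZE i; have sampE : samp Y pi i.+1 w = Num.max (D i) (L i + theta).
  by rewrite -deliv_add_wait -ZE.
have samp_lt : samp Y pi i.+1 w < D i.+1 by rewrite ltrDl (lt_le_trans eps0).
have D_samp : D i <= samp Y pi i.+1 w by rewrite sampE le_max lexx.
rewrite inf_waits//; exists (samp Y pi i.+1 w) => //; split => //.
by rewrite (ageE (i := i)) ?D_samp// lerBrDl sampE le_max lexx orbT.
Qed.

End threshold_rule.

Section threshold_pol.
Context {d : measure_display} {Omega : measurableType d} {R : realType}.
Variables (P : probability Omega R) (alpha eps theta : R).
Variables (Y : nat -> Omega -> R) (succ : nat -> Omega -> bool).
Hypothesis sys : update_system P alpha eps Y succ.

Let eps0 : 0 < eps. Proof. exact: time_bound_gt0 sys. Qed.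

Lemma threshold_policyP pi : in_Pi P Y succ pi ->
  threshold_policy P Y succ pi theta <->
  {ae P, forall w, waits_until Y succ pi theta w}.
Proof.
move=> piP; have Z_ge0 w i := wait_ge0 piP i w; split=> [/ae_foralln thr|wait i].
  apply: filterS2 (times_ge_ae sys) thr => w Yw.
  exact: (wait_of_threshold eps0 Yw (Z_ge0 w)).
apply: filterS2 (times_ge_ae sys) wait => w Yw Zw.
exact: (threshold_of_wait eps0 Yw (Z_ge0 w) Zw).
Qed.

(* The value of [deliv_age] for [threshold_pol], defined ahead of that policy because its
   waiting times depend on it *)
Fixpoint threshold_age (i : nat) (w : Omega) : R :=
  if i is j.+1 then
    (if succ j.+1 w then Y j.+1 w else Num.max (threshold_age j w) theta + Y j.+1 w)
  else 0.

Definition threshold_pol : policy (Omega := Omega) (R := R) :=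
  Policy (fun=> 0) (fun i w => Num.max (theta - threshold_age i w) 0).

Lemma deliv_age_threshold_pol i w :
  deliv_age Y succ threshold_pol i w = threshold_age i w.
Proof.
elim: i => [|i IHi]; first exact: deliv_age0.
by rewrite deliv_ageS IHi/= addr_maxr subrKC addr0 maxC.
Qed.

Lemma sigma_measurable_threshold_age i :
  sigma_measurable (history Y succ threshold_pol i) (threshold_age i).
Proof.
elim: i => [|i IHi]; first exact: measurable_cst.
have msucc := @sigma_measurable_succ _ _ _ Y succ threshold_pol i.
rewrite (_ : threshold_age i.+1 = fun w =>
  (1 - succR succ i.+1 w) * Num.max (threshold_age i w) theta + Y i.+1 w); last first.
  by apply/funext => w /=; rewrite /succR; case: (succ i.+1 w) => /=; ring.
apply: measurable_funD; last exact: sigma_measurable_time.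
apply: measurable_funM; first exact: measurable_funB.
by apply: measurable_maxr => //; exact: sigma_measurable_historyS.
Qed.

Lemma threshold_pol_in_Pi : 0 <= theta -> in_Pi P Y succ threshold_pol.
Proof.
move=> theta0; split.
- exact: measurable_cst.
- exact: indep_sigma_cst.
- by move=> i w /=; rewrite le_max lexx orbT.
- move=> i; apply/(sigma_measurableP (history Y succ threshold_pol i)).
  by apply: measurable_maxr => //; apply: measurable_funB => //;
    exact: sigma_measurable_threshold_age.
- move=> n; exists (fun=> theta); split => //.
  + apply: filterS (times_ge_ae sys) => w Yw /=; rewrite ge_max theta0 andbT gerBl.
    have Y0 i : 0 <= Y i.+1 w by exact: le_trans (ltW eps0) (Yw i).
    case: n => [//|n] /=; case: ifP => // _.
    by rewrite addr_ge0// le_max theta0 orbT.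
  + by rewrite expectation_cst ltry.
  + exact: indep_sigma_cst.
Qed.

Lemma threshold_pol_threshold : 0 <= theta -> threshold_policy P Y succ threshold_pol theta.
Proof.
move=> theta0; apply/(threshold_policyP (threshold_pol_in_Pi theta0)).
by apply: aeW => w i; rewrite deliv_age_threshold_pol.
Qed.

End threshold_pol.

Section threshold_exists.
Context {d : measure_display} {Omega : measurableType d} {R : realType}.
Variables (P : probability Omega R) (X : Omega -> R) (m s : R).
Hypotheses (X_mean : has_mean P X m) (X2_mean : has_mean P (fun w => X w ^+ 2) s).

Definition mean_sqr_excess (x : R) : R := \int[P]_w sqr_excess x (X w).

Lemma has_mean_sqr_excess x :
  has_mean P (fun w => sqr_excess x (X w)) (mean_sqr_excess x).
Proof.
apply: ae_le_normr_has_mean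
  (has_meanD (has_meanZ 2 X2_mean) (has_mean_cst P (2 * x ^+ 2))) _ _.
  apply: measurableT_comp; first exact: measurable_sqr_excess.
  exact: has_mean_measurable X_mean.
by apply: aeW => w; have /andP[? ?] := sqr_excess_le x (X w); rewrite ger0_norm.
Qed.

Lemma continuous_mean_sqr_excess : continuous mean_sqr_excess.
Proof.
move=> x; have x_in : x \in `]x - 1, x + 1[%classic.
  by rewrite inE/= in_itv/=; apply/andP; split; lra.
have excess_int y : `]x - 1, x + 1[%classic y ->
    P.-integrable setT (EFin \o (fun w => sqr_excess y (X w))).
  by case: (has_mean_sqr_excess y).
have excess_cont : {ae P, forall w, setT w ->
    {in `]x - 1, x + 1[%classic, continuous (fun y => sqr_excess y (X w))}}.
  by apply: aeW => w _ y _; exact: continuous_sqr_excess.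
have [dominant_int _] :=
  has_meanD (has_meanZ 2 X2_mean) (has_mean_cst P (2 * (`|x| + 1) ^+ 2)).
have dominated y : `]x - 1, x + 1[%classic y -> {ae P, forall w, setT w ->
    `|sqr_excess y (X w)| <= 2 * X w ^+ 2 + 2 * (`|x| + 1) ^+ 2}.
  rewrite /= in_itv/= => /andP[x_y y_x]; apply: aeW => w _.
  have /andP[excess0 excess_le] := sqr_excess_le y (X w); rewrite ger0_norm//.
  have : y ^+ 2 <= (`|x| + 1) ^+ 2.
    rewrite -[y ^+ 2]real_normK ?num_real//; apply: lerXn2r; rewrite ?nnegrE ?addr_ge0// ler_norml.
    by have := ler_norm x; have := ler_norm (- x); rewrite normrN => *; apply/andP; split; lra.
  by lra.
exact: (continuity_under_integral measurableT excess_int excess_cont dominant_int dominated).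
Qed.

Lemma threshold_exists (alpha : R) : 0 <= alpha < 1 -> 0 <= m ->
  exists2 theta, 0 <= theta & threshold_equation P X alpha m s theta.
Proof.
move=> /andP[alpha0 alpha1] m0; have rate0 : 0 < 1 - alpha by rewrite subr_gt0.
pose c := m / (1 - alpha); have c0 : 0 <= c by rewrite divr_ge0// ltW.
pose k := s / (1 - alpha).
have s0 : 0 <= s by case: X2_mean => _ <-; apply: Rintegral_ge0 => w _; exact: sqr_ge0.
have k0 : 0 <= k by rewrite divr_ge0// ltW.
have sE : s = k * (1 - alpha) by rewrite divfK// gt_eqF.
pose G theta := theta ^+ 2 + 2 * alpha * c * theta - alpha * k - mean_sqr_excess theta.
have G_le0 : G 0 <= 0.
  have : 0 <= mean_sqr_excess 0 by apply: Rintegral_ge0 => w _; exact: sqr_ge0.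
  by have := mulr_ge0 alpha0 k0; rewrite /G expr0n/= mulr0; lra.
have G_ge0 : 0 <= G (k + 1).
  have : mean_sqr_excess (k + 1) <= s.
    apply: ae_le_has_mean (has_mean_sqr_excess _) X2_mean _; apply: aeW => w.
    by apply: sqr_excess_le_sqr; rewrite addr_ge0.
  have : 0 <= alpha * c * (k + 1) by apply: mulr_ge0; [exact: mulr_ge0|exact: addr_ge0].
  by have := sqr_ge0 k; rewrite /G sE !expr2; lra.
have G_cont : {within `[0, k + 1], continuous G}.
  apply: continuous_subspaceT => x; apply: cvgB; last exact: continuous_mean_sqr_excess.
  apply: cvgB; last exact: cvg_cst.
  by apply: cvgD; [exact: exprn_continuous|exact: mulrl_continuous].
have [||theta] := @IVT _ G 0 (k + 1) 0 _ G_cont; first by rewrite addr_ge0.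
  by rewrite ge_min G_le0 le_max G_ge0 orbT.
rewrite in_itv/= => /andP[theta0 _] Gtheta; exists theta => //.
rewrite /threshold_equation (_ : _ - _ = mean_sqr_excess theta).
  exact: has_mean_sqr_excess.
by apply: subr0_eq; rewrite -Gtheta /G /c /k; ring.
Qed.

End threshold_exists.

(** * The root equation *)

Section arithmetico_geometric_series.
Context {R : realType}.
Variable alpha : R.
Hypothesis alpha01 : 0 <= alpha < 1.

Let rate0 : 0 < 1 - alpha. Proof. by rewrite subr_gt0; case/andP: alpha01. Qed.

Lemma series_natmul_exprn n : series (fun k => k%:R * alpha ^+ k) n =
  (alpha * (1 - alpha ^+ n) - (1 - alpha) * (n%:R * alpha ^+ n)) / (1 - alpha) ^+ 2.
Proof.
have rate_neq0 : 1 - alpha != 0 by rewrite gt_eqF.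
elim: n => [|n IHn]; first by rewrite /series/= big_geq//; field.
by rewrite seriesSr IHn (exprS alpha n) -natr1; field.
Qed.

Lemma cvg_exprn : alpha ^+ n @[n --> \oo] --> 0.
Proof. by case/andP: alpha01 => ? ?; apply: cvg_expr; rewrite ger0_norm. Qed.

Lemma cvg_natmul_exprn : n%:R * alpha ^+ n @[n --> \oo] --> 0.
Proof.
have [alpha0 alpha1] := andP alpha01.
have term0 n : 0 <= n%:R * alpha ^+ n by rewrite mulr_ge0// exprn_ge0.
apply: (cvg_series_cvg_0 (u_ := fun n => n%:R * alpha ^+ n)); apply: nondecreasing_is_cvgn.
  by apply: nondecreasing_series => n _ _.
exists (alpha / (1 - alpha) ^+ 2) => _ [n _ <-].
rewrite series_natmul_exprn ler_pM2r ?invr_gt0 ?exprn_gt0//.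
have : 0 <= alpha * alpha ^+ n by rewrite mulr_ge0// exprn_ge0.
by have := mulr_ge0 (ltW rate0) (term0 n); lra.
Qed.

Lemma cvg_series_natmul_exprn :
  series (fun k => k%:R * alpha ^+ k) n @[n --> \oo] --> alpha / (1 - alpha) ^+ 2.
Proof.
rewrite (_ : series _ = fun n =>
  (alpha * (1 - alpha ^+ n) - (1 - alpha) * (n%:R * alpha ^+ n)) / (1 - alpha) ^+ 2); last first.
  by apply/funext => n; exact: series_natmul_exprn.
rewrite [X in _ --> X](_ : _ = (alpha * (1 - 0) - (1 - alpha) * 0) / (1 - alpha) ^+ 2); last first.
  by rewrite subr0 mulr1 mulr0 subr0.
apply: cvgMl; apply: cvgB; apply: cvgMr; last exact: cvg_natmul_exprn.
by apply: cvgB; [exact: cvg_cst|exact: cvg_exprn].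
Qed.

End arithmetico_geometric_series.

Section geometric_distribution.
Context {d : measure_display} {Omega : measurableType d} {R : realType}.
Variables (P : probability Omega R) (alpha : R) (M : Omega -> nat).
Hypothesis alpha01 : 0 <= alpha < 1.
Hypothesis mM : measurable_fun setT (fun w => (M w)%:R : R).
Hypothesis PM : forall k, (1 <= k)%N ->
  P [set w | M w = k] = (alpha ^+ k.-1 * (1 - alpha))%:E.

(* [PM] says nothing of the event [M = 0]: it is null because the tails of [M] vanish. *)
Let atom0 : R := fine (P [set w | M w = 0%N]).

Let has_mean_atom k : has_mean P (\1_[set w | M w = k] : Omega -> R)
  (fine (P [set w | M w = k])).
Proof.
have mMk : measurable [set w | M w = k].
  rewrite (_ : [set w | _] = (fun w => (M w)%:R : R) @^-1` [set k%:R]).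
    exact: preimage_measurable.
  by apply/seteqP; split => w /=; [move=> ->|move/eqP; rewrite eqr_nat => /eqP].
by split; [exact: integrable_indic|rewrite /Rintegral integral_indic// setIT].
Qed.

Let has_mean_tail_sub k : has_mean P (fun w => (k < M w)%N%:R) (alpha ^+ k - atom0).
Proof.
elim: k => [|k IHk].
  apply: eq_has_mean (has_meanB (has_mean_cst P 1) (has_mean_atom 0)) => w.
  rewrite indicE; have [Mw|Mw] := posnP (M w); first by rewrite mem_set// subrr.
  by rewrite memNset ?subr0//= => Mw0; rewrite Mw0 in Mw.
rewrite (_ : _ - atom0 = alpha ^+ k - atom0 - fine (P [set w | M w = k.+1])).
  apply: eq_has_mean (has_meanB IHk (has_mean_atom k.+1)) => w; rewrite indicE.
  case: (ltngtP (M w) k.+1) => Mw; last by rewrite mem_set// subrr.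
  - by rewrite memNset ?subrr//= => MwE; rewrite MwE ltnn in Mw.
  - by rewrite memNset ?subr0//= => MwE; rewrite MwE ltnn in Mw.
by rewrite PM//= exprS; ring.
Qed.

Lemma has_mean_geometric_tail k : has_mean P (fun w => (k < M w)%N%:R) (alpha ^+ k).
Proof.
suff atom00 : atom0 = 0 by have := has_mean_tail_sub k; rewrite atom00 subr0.
apply/eqP; rewrite eq_le fine_ge0// andbT.
have atom_le n : atom0 <= alpha ^+ n.
  rewrite -subr_ge0; apply: ae_le_has_mean (has_mean_cst P 0) (has_mean_tail_sub n) _.
  by apply: aeW => w; exact: ler0n.
have atom_cst : (fun _ : nat => atom0) @ \oo --> atom0 by exact: cvg_cst.
by apply: (ler_cvg_to atom_cst (cvg_exprn alpha01)); exact: nearW.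
Qed.

End geometric_distribution.

Section compound_geometric.
Context {d : measure_display} {Omega : measurableType d} {R : realType}.
Variables (B : Omega -> R) (M : Omega -> nat) (W : nat -> Omega -> R).

Definition compound_family (k : nat) : Omega -> R :=
  match k with 0%N => B | 1%N => fun w => (M w)%:R | j.+2 => W j end.

Definition partial_sum n w : R := B w + \sum_(k < n) W k w.

(* [partial_sum (minn n (M w)) w], written so that the indicators of the events [k < M]
   factor out *)
Definition stopped_partial_sum n w : R := B w + \sum_(k < n) (k < M w)%N%:R * W k w.

Lemma stopped_partial_sum_lt n w : (n <= M w)%N -> stopped_partial_sum n w = partial_sum n w.
Proof.
move=> nM; congr (_ + _); apply: eq_bigr => k _.
by rewrite (leq_trans (ltn_ord k) nM) mul1r.
Qed.

Lemma stopped_partial_sum_ge n w : (M w <= n)%N ->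
  stopped_partial_sum n w = partial_sum (M w) w.
Proof.
move=> Mn; congr (_ + _); rewrite (big_ord_widen _ (W ^~ w) Mn) [RHS]big_mkcond/=.
by apply: eq_bigr => k _; case: (k < M w)%N; rewrite ?mul1r ?mul0r.
Qed.

Lemma stopped_partial_sumS_sqr n w : stopped_partial_sum n.+1 w ^+ 2 =
  stopped_partial_sum n w ^+ 2
  + (n < M w)%N%:R * (2 * (partial_sum n w * W n w) + W n w ^+ 2).
Proof.
rewrite {1}/stopped_partial_sum big_ord_recr/= addrA -/(stopped_partial_sum n w).
case: ltnP => nM; last by rewrite !mul0r !addr0.
by rewrite stopped_partial_sum_lt 1?ltnW// !mul1r; ring.
Qed.

Variables (P : probability Omega R) (alpha m s muB muB2 : R).
Hypotheses (alpha01 : 0 <= alpha < 1) (B0 : forall w, 0 <= B w)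
  (W0 : forall k w, 0 <= W k w).
Hypothesis mM : measurable_fun setT (fun w => (M w)%:R : R).
Hypothesis PM : forall k, (1 <= k)%N ->
  P [set w | M w = k] = (alpha ^+ k.-1 * (1 - alpha))%:E.
Hypothesis ind : mutually_independent P compound_family.
Hypotheses (B_mean : has_mean P B muB) (B2_mean : has_mean P (fun w => B w ^+ 2) muB2)
  (W_mean : forall k, has_mean P (W k) m)
  (W2_mean : forall k, has_mean P (fun w => W k w ^+ 2) s).

Let measurable_family k : measurable_fun setT (compound_family k).
Proof.
by case: k => [|[|k]]; [exact: has_mean_measurable B_mean|exact: mM|
  exact: has_mean_measurable (W_mean k)].
Qed.

Local Notation components J := [set f | exists2 i, J i & f = compound_family i].

Let sigma_measurable_B (J : set nat) : J 0%N -> sigma_measurable (components J) B.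
Proof. by move=> J0; apply: sigma_measurable_gen; exists 0%N. Qed.

Let sigma_measurable_W (J : set nat) k : J k.+2 -> sigma_measurable (components J) (W k).
Proof. by move=> Jk; apply: sigma_measurable_gen; exists k.+2. Qed.

Let sigma_measurable_partial_sum (J : set nat) n : J 0%N ->
  (forall k, (k < n)%N -> J k.+2) -> sigma_measurable (components J) (partial_sum n).
Proof.
move=> J0 JW; apply: measurable_funD; first exact: sigma_measurable_B.
by apply: measurable_sum => k; apply: sigma_measurable_W; exact: JW.
Qed.

Lemma has_mean_partial_sum n : has_mean P (partial_sum n) (muB + n%:R * m).
Proof.
rewrite mulr_natl -[X in _ *+ X]card_ord -sumr_const.
by apply: has_meanD => //; exact: has_mean_sum.
Qed.

Lemma has_mean_partial_sum_mul n :
  has_mean P (fun w => partial_sum n w * W n w) ((muB + n%:R * m) * m).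
Proof.
have disj : [set j | (j < n.+2)%N] `&` [set n.+2] = set0.
  by apply/seteqP; split => // j [/= jn jE]; rewrite jE ltnn in jn.
have indJ := mutually_independent_blocks measurable_family ind disj.
apply: has_mean_mul_indep indJ _ _ (has_mean_partial_sum n) (W_mean n);
  apply/sigma_measurableP.
- exact: sigma_measurable_partial_sum.
- exact: sigma_measurable_W.
Qed.

Lemma has_mean_stopped_partial_sum_sqr n : has_mean P (fun w => stopped_partial_sum n w ^+ 2)
  (muB2 + \sum_(k < n) alpha ^+ k * (2 * ((muB + k%:R * m) * m) + s)).
Proof.
elim: n => [|n IHn].
  rewrite big_ord0 addr0; apply: eq_has_mean B2_mean => w.
  by rewrite /stopped_partial_sum big_ord0 addr0.
rewrite big_ord_recr/= addrA; apply: eq_has_mean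
  (fun w => esym (stopped_partial_sumS_sqr n w)) (has_meanD IHn _).
have disj : [set 1%N] `&` [set j | j != 1%N] = set0.
  by apply/seteqP; split => // j [/= ->].
have indJ := mutually_independent_blocks measurable_family ind disj.
apply: has_mean_mul_indep indJ _ _ (has_mean_geometric_tail alpha01 mM PM n)
  (has_meanD (has_meanZ 2 (has_mean_partial_sum_mul n)) (W2_mean n));
  apply/sigma_measurableP.
- rewrite (_ : (fun w => _) = fun w => (n%:R < (M w)%:R :> R)%R%:R); last first.
    by apply/funext => w; rewrite ltr_nat.
  apply: measurable_fun_natrb; apply: measurable_fun_ltr => //.
  by apply: sigma_measurable_gen; exists 1%N.
- have mW : sigma_measurable (components [set j | j != 1%N]) (W n).
    exact: sigma_measurable_W.
  apply: measurable_funD; last exact: measurable_funX.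
  by do 2 apply: measurable_funM => //; exact: sigma_measurable_partial_sum.
Qed.

Lemma cvg_stopped_partial_sum_sqr_mean :
  muB2 + \sum_(k < n) alpha ^+ k * (2 * ((muB + k%:R * m) * m) + s) @[n --> \oo] -->
  muB2 + 2 * (m / (1 - alpha)) * muB
  + (s + 2 * alpha * (m / (1 - alpha)) * m) / (1 - alpha).
Proof.
have /andP[alpha0 alpha1] := alpha01.
have rate0 : 1 - alpha != 0 by rewrite gt_eqF// subr_gt0.
have geom : series (geometric 1 alpha) n @[n --> \oo] --> 1 * (1 - alpha)^-1.
  by apply: cvg_geometric_series; rewrite ger0_norm.
rewrite (_ : (fun n => _) = fun n => muB2 + ((2 * muB * m + s) * series (geometric 1 alpha) n
  + 2 * m ^+ 2 * series (fun k => k%:R * alpha ^+ k) n)); last first.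
  apply/funext => n; rewrite /series/= !big_mkord !mulr_sumr -big_split/=.
  by congr (_ + _); apply: eq_bigr => k _; rewrite /geometric; ring.
rewrite (_ : muB2 + _ + _ = muB2 + ((2 * muB * m + s) * (1 * (1 - alpha)^-1)
  + 2 * m ^+ 2 * (alpha / (1 - alpha) ^+ 2))); last by field.
apply: cvgD; first exact: cvg_cst.
by apply: cvgD; apply: cvgMr => //; exact: cvg_series_natmul_exprn.
Qed.

Let stopped_partial_sum_ge0 n w : 0 <= stopped_partial_sum n w.
Proof. by apply: addr_ge0 => //; apply: sumr_ge0 => k _; rewrite mulr_ge0. Qed.

Let cvg_stopped_partial_sum_sqr w :
  stopped_partial_sum n w ^+ 2 @[n --> \oo] --> partial_sum (M w) w ^+ 2.
Proof.
apply: cvg_near_cst; exists (M w) => // n /= Mn.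
by rewrite stopped_partial_sum_ge.
Qed.

Let stopped_partial_sum_nondecreasing w : nondecreasing_seq (stopped_partial_sum ^~ w).
Proof.
apply/nondecreasing_seqP => n; rewrite /stopped_partial_sum big_ord_recr/= lerD2l lerDl.
by rewrite mulr_ge0.
Qed.

Let measurable_stopped_sqr n : measurable_fun setT (fun w => stopped_partial_sum n w ^+ 2).
Proof. exact: has_mean_measurable (has_mean_stopped_partial_sum_sqr n). Qed.

Let cvg_integral_stopped_partial_sum_sqr :
  (\int[P]_w (stopped_partial_sum n w ^+ 2)%:E @[n --> \oo] -->
   \int[P]_w (partial_sum (M w) w ^+ 2)%:E)%E.
Proof.
rewrite [X in _ --> X](_ : _ =
    \int[P]_w limn (fun n => (stopped_partial_sum n w ^+ 2)%:E))%E; last first.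
  apply: eq_integral => w _; apply/esym/cvg_lim => //.
  by apply: cvg_EFin; [exact: nearW|exact: cvg_stopped_partial_sum_sqr].
apply: cvg_monotone_convergence => //.
- by move=> n; exact/measurable_EFinP.
- by move=> n w _; rewrite lee_fin sqr_ge0.
- move=> w _ i j ij; rewrite lee_fin; apply: lerXn2r; rewrite ?nnegrE//.
  exact: stopped_partial_sum_nondecreasing.
Qed.

Let cvg_mean_stopped_partial_sum_sqr :
  (\int[P]_w (stopped_partial_sum n w ^+ 2)%:E @[n --> \oo] -->
   (muB2 + 2 * (m / (1 - alpha)) * muB
    + (s + 2 * alpha * (m / (1 - alpha)) * m) / (1 - alpha))%:E)%E.
Proof.
have meanE n := has_mean_integral (has_mean_stopped_partial_sum_sqr n).
rewrite (eq_cvg _ _ meanE).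
by apply: cvg_EFin; [exact: nearW|exact: cvg_stopped_partial_sum_sqr_mean].
Qed.

Lemma has_mean_compound_geometric_sqr : has_mean P (fun w => partial_sum (M w) w ^+ 2)
  (muB2 + 2 * (m / (1 - alpha)) * muB
   + (s + 2 * alpha * (m / (1 - alpha)) * m) / (1 - alpha)).
Proof.
apply: ge0_has_mean => [|w|].
- by apply: (measurable_fun_cvg (h := fun n w => stopped_partial_sum n w ^+ 2)).
- exact: sqr_ge0.
- exact: cvg_unique cvg_integral_stopped_partial_sum_sqr cvg_mean_stopped_partial_sum_sqr.
Qed.

End compound_geometric.

Section root_equation.
Context {d : measure_display} {Omega : measurableType d} {R : realType}.
Variables (P : probability Omega R) (alpha eps theta : R).
Variables (Y : nat -> Omega -> R) (succ : nat -> Omega -> bool).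
Hypothesis sys : update_system P alpha eps Y succ.
Local Notation m := (mean_time P Y).
Local Notation s := (mean_time_sqr P Y).
Local Notation c := (m / (1 - alpha)).
Hypotheses (theta0 : 0 <= theta) (thetaE : threshold_equation P (Y 1%N) alpha m s theta).

Let mY : forall i, measurable_fun setT (Y i). Proof. exact: measurable_time sys. Qed.

Section realization.
Context {d' : measure_display} {Omega' : measurableType d'}.
Variables (P' : probability Omega' R) (Yr : Omega' -> R) (M : Omega' -> nat)
  (Ys : nat -> Omega' -> R).
Hypotheses (mYr : measurable_fun setT Yr) (mYs : forall k, measurable_fun setT (Ys k)).
Hypotheses (lawYr : law_eq P P' (Y 1%N) Yr)
  (lawYs : forall k, (1 <= k)%N -> law_eq P P' (Y 1%N) (Ys k)).

Let has_mean_Yr (g : R -> R) a : measurable_fun setT g ->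
  has_mean P (fun w => g (Y 1%N w)) a -> has_mean P' (fun w => g (Yr w)) a.
Proof. exact: (law_eq_has_mean (X := Y 1%N) (mY 1%N) mYr lawYr). Qed.

Let has_mean_Ys (g : R -> R) a k : measurable_fun setT g ->
  has_mean P (fun w => g (Y 1%N w)) a -> has_mean P' (fun w => g (Ys k.+1 w)) a.
Proof. exact: (law_eq_has_mean (X := Y 1%N) (mY 1%N) (mYs k.+1) (lawYs (ltn0Sn k))). Qed.

Let Yr_mean : has_mean P' Yr m.
Proof. by apply: (has_mean_Yr (g := id)); last exact: has_mean_time sys 0. Qed.

Let Yr2_mean : has_mean P' (fun w => Yr w ^+ 2) s.
Proof. by apply: (has_mean_Yr (exprn_measurable 2)); exact: has_mean_time_sqr sys 0. Qed.

Let Ys_ge0 : {ae P', forall w, forall k, 0 <= Ys k.+1 w}.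
Proof.
apply: ae_foralln => k.
have := law_eq_ae (mY 1%N) (mYs k.+1) (lawYs (ltn0Sn k)) (measurable_itv `[0, +oo[).
move=> ge_ae; have {ge_ae}: {ae P', forall w, `[0, +oo[%classic (Ys k.+1 w)}.
  apply: ge_ae; apply: filterS (time_ge_ae sys) => w; rewrite /= in_itv/= andbT.
  by apply: le_trans; exact: ltW (time_bound_gt0 sys).
by apply: filterS => w; rewrite /= in_itv/= andbT.
Qed.

Let sampling_age w : R := Num.max theta (Yr w).
Let peak_age w : R := partial_sum sampling_age (fun k w => Num.max (Ys k.+1 w) 0) (M w) w.
Let mean_sampling_age : R := \int[P']_w sampling_age w.

Let has_mean_sampling_age : has_mean P' sampling_age mean_sampling_age.
Proof.
apply: ae_le_normr_has_mean (has_meanD (has_mean_cst P' (theta + 1)) Yr2_mean) _ _.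
  exact: measurable_maxr.
apply: aeW => w; rewrite ger0_norm ?le_max ?theta0// ge_max; apply/andP; split.
  by rewrite -addrA lerDl addr_ge0 ?sqr_ge0.
have theta_ge0 := theta0; have := sqr_ge0 (Yr w - 1); have := sqr_ge0 (Yr w).
by rewrite !expr2; lra.
Qed.

Let has_mean_sampling_age_sqr : has_mean P' (fun w => sampling_age w ^+ 2)
  (2 * alpha * c * theta - alpha * s / (1 - alpha) + 2 * theta * mean_sampling_age).
Proof.
have excess_mean := has_mean_Yr (@measurable_sqr_excess R theta) thetaE.
have := has_meanB (has_meanD excess_mean (has_meanZ (2 * theta) has_mean_sampling_age))
  (has_mean_cst P' (theta ^+ 2)).
set v := (X in has_mean _ _ X) => v_mean.
rewrite [X in has_mean _ _ X](_ : _ = v); last by rewrite /v; ring.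
apply: eq_has_mean v_mean => w; rewrite /sampling_age /sqr_excess.
have [?|?] := leP theta (Yr w); [rewrite max_l|rewrite max_r]; by [lra|ring].
Qed.

Hypothesis mM : measurable_fun setT (fun w => (M w)%:R : R).
Hypothesis PM : forall k, (1 <= k)%N ->
  P' [set w | M w = k] = (alpha ^+ k.-1 * (1 - alpha))%:E.
Hypothesis ind : mutually_independent P' (fun k : nat => match k with
  | 0%N => Yr | 1%N => fun w => (M w)%:R | k'.+2 => Ys k'.+1 end).

Let has_mean_peak_age_sqr : has_mean P' (fun w => peak_age w ^+ 2)
  (2 * (theta + c) * (mean_sampling_age + alpha * c) + s).
Proof.
have rate_neq0 : 1 - alpha != 0 by rewrite gt_eqF// (success_rate_gt0 sys).
pose clip (k : nat) : R -> R :=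
  match k with 0%N => Num.max theta | 1%N => id | _ => fun x => Num.max x 0 end.
have mclip k : measurable_fun setT (clip k).
  by case: k => [|[|k]]; [exact: measurable_maxr|exact: measurable_id|exact: measurable_maxr].
have ind_clip : mutually_independent P'
    (compound_family sampling_age M (fun k w => Num.max (Ys k.+1 w) 0)).
  have := mutually_independent_comp ind mclip.
  by congr (mutually_independent _ _); apply/funext => -[|[|k]].
have mid : measurable_fun setT (@id R) by exact: measurable_id.
have Ys_clip (g : R -> R) a k : measurable_fun setT g ->
    has_mean P (fun w => g (Y 1%N w)) a -> has_mean P' (fun w => g (Num.max (Ys k.+1 w) 0)) a.
  move=> mg gY; apply: (ae_eq_has_mean (has_mean_Ys k mg gY)).
    by apply: measurableT_comp => //; exact: measurable_maxr.
  by apply: filterS Ys_ge0 => w Ys0; rewrite max_l.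
have := has_mean_compound_geometric_sqr (loss_rate_bounds sys) _ _ mM PM ind_clip
  has_mean_sampling_age has_mean_sampling_age_sqr
  (fun k => Ys_clip id m k mid (has_mean_time sys 0))
  (fun k => Ys_clip _ s k (exprn_measurable 2) (has_mean_time_sqr sys 0)).
rewrite (_ : _ + _ / _ = 2 * (theta + c) * (mean_sampling_age + alpha * c) + s); last by field.
by apply=> [w|k w]; rewrite le_max ?theta0 ?lexx ?orbT.
Qed.

Let integral_peak_age :
  (\int[P']_w (\int[@lebesgue_measure R]_(t in `[Yr w, (Num.max theta (Yr w)
     + \sum_(1 <= k < (M w).+1) Ys k w)%R]) t%:E) =
   ((theta + c) * (mean_sampling_age + alpha * c))%:E)%E.
Proof.
rewrite (_ : _ * _ = 2^-1 * (2 * (theta + c) * (mean_sampling_age + alpha * c) + s - s)).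
  rewrite -(has_mean_integral (has_meanZ 2^-1 (has_meanB has_mean_peak_age_sqr Yr2_mean))).
  apply: eq_ae_integral; apply: filterS Ys_ge0 => w Ys0.
  rewrite (_ : _ + _ = peak_age w); last first.
    by congr (_ + _); rewrite big_add1 big_mkord; apply: eq_bigr => k _; rewrite max_l.
  have Yr_peak : Yr w <= peak_age w.
    apply: (@le_trans _ _ (sampling_age w)); first by rewrite le_max lexx orbT.
    by rewrite lerDl; apply: sumr_ge0 => k _; rewrite le_max lexx orbT.
  have := integral_subr 0 Yr_peak; rewrite !subr0 [_ / 2]mulrC => <-.
  by apply: eq_integral => t _; rewrite subr0.
by field; rewrite gt_eqF// (success_rate_gt0 sys).
Qed.

Let expectation_cycle_length :
  ('E_P'[fun w => Num.max (theta + c - Yr w)%R c] = (mean_sampling_age + alpha * c)%:E)%E.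
Proof.
apply: has_mean_expectation.
have := has_meanD (has_meanB has_mean_sampling_age Yr_mean) (has_mean_cst P' c).
rewrite (_ : _ - m + c = mean_sampling_age + alpha * c).
  apply: eq_has_mean => w; rewrite /sampling_age.
  by have [?|?] := leP theta (Yr w); [rewrite max_r|rewrite max_l]; try lra; ring.
by field; rewrite gt_eqF// (success_rate_gt0 sys).
Qed.

Lemma threshold_root_eq_realization :
  (\int[P']_w (\int[@lebesgue_measure R]_(t in `[Yr w, (Num.max theta (Yr w)
       + \sum_(1 <= k < (M w).+1) Ys k w)%R]) t%:E)
   - (theta + c)%:E * 'E_P'[fun w => Num.max (theta + c - Yr w)%R c])%E = 0%E.
Proof.
by rewrite integral_peak_age expectation_cycle_length -EFinM -EFinB subrr.
Qed.

End realization.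

Lemma threshold_root_eq : root_eq P Y alpha (theta + c).
Proof.
move=> d' Omega' P' Yr M Ys mYr mM mYs lawYr lawYs PM ind /=.
rewrite (cY_mean_time sys) addrK.
exact: (threshold_root_eq_realization mYr mYs lawYr lawYs mM PM ind).
Qed.

End root_equation.

Theorem mainTheorem10 (d : measure_display) (Omega : measurableType d) (R : realType)
  (P : probability Omega R) (alpha eps : R)
  (Y : nat -> Omega -> R) (succ : nat -> Omega -> bool) :
  0 <= alpha < 1 -> 0 < eps ->
  (forall i, measurable_fun setT (Y i)) ->
  (forall i, measurable_fun setT (@succR _ _ R succ i)) ->
  mutually_independent P (sys_family Y succ) ->
  (forall i, (1 <= i)%N -> law_eq P P (Y i) (Y 1%N)) ->
  (forall i, (1 <= i)%N -> P [set w | succ i w] = (1 - alpha)%:E) ->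
  {ae P, forall w, eps <= Y 1%N w} ->
  ('E_P[fun w => (Y 1%N w ^+ 2)%R] < +oo)%E ->
  exists beta : R,
    [/\ age_opt P Y succ = beta%:E,
        root_eq P Y alpha beta,
        (exists pi, in_Pi P Y succ pi /\ threshold_policy P Y succ pi (beta - cY P Y alpha)) &
        (forall pi, in_Pi P Y succ pi -> threshold_policy P Y succ pi (beta - cY P Y alpha) ->
           avg_cost P Y succ pi = beta%:E)].
Proof.
move=> alpha01 eps0 mY msucc indY lawY Psucc Y_ge Y2_fin.
have sys : update_system P alpha eps Y succ by exact: UpdateSystem.
have [theta theta0 thetaE] := threshold_exists (has_mean_time sys 0)
  (has_mean_time_sqr sys 0) alpha01 (mean_time_ge0 sys).
have optimal pi : in_Pi P Y succ pi -> threshold_policy P Y succ pi theta ->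
    avg_cost P Y succ pi = (theta + cY P Y alpha)%:E.
  move=> piP /(threshold_policyP _ sys piP) Z_thr; rewrite (cY_mean_time sys).
  by apply/eqP; rewrite eq_le (avg_cost_le sys)// (avg_cost_ge sys).
have thr_in := threshold_pol_in_Pi sys theta0; have thr := threshold_pol_threshold sys theta0.
exists (theta + cY P Y alpha); rewrite addrK; split => //.
- apply/eqP; rewrite eq_le; apply/andP; split.
    by apply: ereal_inf_lbound; exists (threshold_pol theta Y succ) => //; exact: optimal.
  apply: le_ereal_inf_tmp => _ [pi piP <-].
  by rewrite (cY_mean_time sys) (avg_cost_ge sys).
- by rewrite (cY_mean_time sys); exact: threshold_root_eq sys theta0 thetaE.
- by exists (threshold_pol theta Y succ).
Qed.
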